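(* Consider the infinite-horizon average-cost networked storage control problem (P) and the Online Modified Greedy (OMG) algorithm, both defined in the context, under the standing assumptions stated there, and with algorithm parameters $(\Gamma_i, W_i)$, $i=1,\dots,n$, satisfying $0< W_i\le W_i^{\max}$ and $\Gamma_i^{\min}\le \Gamma_i\le\Gamma_i^{\max}$ for every $i$. Let $(u^{\mathrm{ol}},r^{\mathrm{ol}},\theta^{\mathrm{ol}},f^{\mathrm{ol}})=\{(u^{\mathrm{ol}}(t),r^{\mathrm{ol}}(t),\theta^{\mathrm{ol}}(t),f^{\mathrm{ol}}(t)) : t\ge 1\}$ be the control sequence generated by the OMG algorithm. Then this control sequence is feasible with respect to all constraints of (P) (in particular, the storage levels it induces satisfy $S_i^{\min}\le s_i(t)\le S_i^{\max}$ for all $i$ and $t$), and its sub-optimality is bounded by $\sum_{i=1}^n M_i(\Gamma_i)/W_i$, that is, $$J^\star \le J(u^{\mathrm{ol}},r^{\mathrm{ol}},\theta^{\mathrm{ol}},f^{\mathrm{ol}})\le J^\star+\sum_{i=1}^n \frac{M_i(\Gamma_i)}{W_i},$$ where $$M_i(\Gamma_i)=M_i^{u}(\Gamma_i)+\lambda_i(1-\lambda_i)M_i^{s}(\Gamma_i),$$ $$M_i^{u}(\Gamma_i)=\tfrac12\max\Big(\big(U_i^{\min}+(1-\lambda_i)\Gamma_i\big)^2,\ \big(U_i^{\max}+(1-\lambda_i)\Gamma_i\big)^2\Big),$$ $$M_i^{s}(\Gamma_i)=\max\Big(\big(S_i^{\min}+\Gamma_i\big)^2,\ \big(S_i^{\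max}+\Gamma_i\big)^2\Big).$$
   Context: **Network and devices.** A power network has buses $1,\dots,n$ and lines between pairs of buses. $B\in\mathbb{R}^{n\times n}$ is the imaginary part of the admittance matrix under DC assumptions ($B$ is symmetric, with $B_{ij}=0$ if there is no line between $i$ and $j$), and $F_{ij}^{\max}=F_{ji}^{\max}>0$ is the capacity of the line connecting $i$ and $j$. Each bus $i$ has a storage with parameters $\lambda_i\in(0,1]$ (efficiency), $S_i^{\min}\le S_i^{\max}$ (storage level bounds) and $U_i^{\min}\le U_i^{\max}$ (control bounds). It also has a cost function $g_i(r;p)$, real-valued and convex in $r\in\mathbb{R}$ for each value of the price parameter $p$. At each period $t=1,2,\dots$ bus $i$ has a stochastic net supply $\delta_i(t)$ and a stochastic price $p_i(t)$. The decision variables at time $t$ are the storage control $u(t)\in\mathbb{R}^n$, conventional generation/curtailment $r(t)\in\mathbb{R}^n$, phase angles $\theta(t)\in\mathbb{R}^n$ and line flows $f(t)=(f_{ij}(t))$. The storage level is $s_i(t)$, with given initial value $s_i(1)\in[S_i^{\min},S_i^{\max}]$. **Problem (P).** Minimize over control policies $$J(u,r,\theta,f)=\lim_{T\to\infty}\frac1T\,\mathbb{E}\Big[\sum_{t=1}^T\sum_{i=1}^n g_i(r_i(t);p_i(t))\Big]$$ subject to, for all $i,j\in\{1,\dots,n\}$ and all $t\ge1$: - $\delta_i(t)+r_i(t)=u_i(t)+\sum_{j=1}^n f_{ij}(t)$; - $s_i(t+1)=\lambda_i s_i(t)+u_i(t)$; - $U_i^{\min}\le u_i(t)\le U_i^{\max}$;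 - $S_i^{\min}\le s_i(t)\le S_i^{\max}$; - $B_{ij}(\theta_i(t)-\theta_j(t))=f_{ij}(t)$; - $-F_{ij}^{\max}\le f_{ij}(t)\le F_{ij}^{\max}$. A control policy maps, at each time $t$, the information available up to time $t$ (including $\delta(t)$, $p(t)$ and $s(t)$) to the decisions $(u(t),r(t),\theta(t),f(t))$. $J^\star$ denotes the minimum cost of (P), and $J(u,r,\theta,f)$ the cost induced by the control sequence $(u,r,\theta,f)$; the limits and expectations defining these costs are taken to exist. **Standing assumptions.** - (IID disturbance) The process $\{(\delta(t),p(t))\in\mathbb{R}^{2n}:t\ge1\}$ is i.i.d. across $t$ and supported on a compact set, with $\delta_i(t)\in[\delta_i^{\min},\delta_i^{\max}]$ and $p_i(t)\in[P_i^{\min},P_i^{\max}]$ for all $i,t$. Arbitrary correlation within one time period is allowed. - (Frequent acting) $U_i^{\max}-U_i^{\min}<S_i^{\max}-S_i^{\min}$ for all $i$. - (Feasibility) $\lambda_iS_i^{\min}+U_i^{\max}\ge S_i^{\min}$ and $\lambda_iS_i^{\max}+U_i^{\min}\le S_i^{\max}$ for all $i$. - (Controllability) $\lambda_iS_i^{\max}+U_i^{\max}\ge S_i^{\max}$ and $\lambda_iS_i^{\min}+U_i^{\min}\le S_i^{\min}$ for all $i$. **Subgradient bounds.** For $y_i=(f,\delta_i,p_i)$ let $\phi_i(u_i,y_i)=g_i\big(u_i-\delta_i+\sum_{j=1}^n f_{ij};\,p_i\big)$, which is convex in $u_i\in\mathbb{R}$. Let $\partial_{u_i}\phi_i(u_i,y_i)$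 be its subdifferential in $u_i$, i.e. the set of $\alpha\in\mathbb{R}$ such that $\phi_i(u',y_i)\ge\phi_i(u_i,y_i)+\alpha(u'-u_i)$ for all $u'\in\mathbb{R}$. Let $$Dg_i=\bigcup_{u_i,\,y_i}\partial_{u_i}\phi_i(u_i,y_i),$$ the union being over $u_i\in[U_i^{\min},U_i^{\max}]$ and $y_i\in\mathcal{F}\times[\delta_i^{\min},\delta_i^{\max}]\times[P_i^{\min},P_i^{\max}]$, where $\mathcal{F}=\{f:-F_{ij}^{\max}\le f_{ij}\le F_{ij}^{\max}\ \forall i,j\}$. Let $\underline{D}g_i<\overline{D}g_i$ be any real numbers with $\underline{D}g_i\le\inf Dg_i\le\sup Dg_i\le\overline{D}g_i$. **Parameter bounds.** $$\Gamma_i^{\min}=\tfrac1{\lambda_i}\big(-W_i\underline{D}g_i+U_i^{\max}-S_i^{\max}\big),\qquad \Gamma_i^{\max}=\tfrac1{\lambda_i}\big(-W_i\overline{D}g_i-S_i^{\min}+U_i^{\min}\big),$$ $$W_i^{\max}=\frac{(S_i^{\max}-S_i^{\min})-(U_i^{\max}-U_i^{\min})}{\overline{D}g_i-\underline{D}g_i}.$$ **OMG algorithm.** At each time $t\ge1$, having observed $s(t),\delta(t),p(t)$, the algorithm takes $(u^{\mathrm{ol}}(t),r^{\mathrm{ol}}(t),\theta^{\mathrm{ol}}(t),f^{\mathrm{ol}}(t))$ to be an optimal solution of the deterministic problem $$\text{minimize}_{u,r,\theta,f}\ \sum_{i=1}^n\Big[\frac{\lambda_i}{W_i}\big(s_i(t)+\Gamma_i\big)u_i+g_i(r_i;p_i(t))\Big]$$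 subject to, for all $i,j$: $U_i^{\min}\le u_i\le U_i^{\max}$, $\ \delta_i(t)+r_i=u_i+\sum_{j=1}^n f_{ij}$, $\ B_{ij}(\theta_i-\theta_j)=f_{ij}$, $\ -F_{ij}^{\max}\le f_{ij}\le F_{ij}^{\max}$. The storage level is then updated by $s_i(t+1)=\lambda_is_i(t)+u_i^{\mathrm{ol}}(t)$. (The storage level constraints are not imposed in this problem.) *)

(* Defs.v *)
From HB Require Import structures.
From mathcomp Require Import all_boot all_order all_algebra.
From mathcomp Require Import all_classical all_reals all_analysis.
Set Implicit Arguments.
Unset Strict Implicit.
Unset Printing Implicit Defensive.
Import Order.TTheory GRing.Theory Num.Theory numFieldNormedType.Exports.

Local Open Scope classical_set_scope.
Local Open Scope ring_scope.

(** Periods are numbered from 0: index [t] stands for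
    period [t + 1], so that [0] is the initial period.  Processes are given
    pathwise, and all pathwise conditions hold for every outcome. *)

Section iid.
Context d d' (T : measurableType d) (T' : measurableType d') (R : realType).

Definition mutually_independent (P : probability T R)
    (X : nat -> {mfun T >-> T'}) : Prop :=
  forall (ts : seq nat) (A : nat -> set T'), uniq ts ->
    (forall t, measurable (A t)) ->
    P (\big[setI/setT]_(t <- ts) (X t @^-1` A t)) =
    (\prod_(t <- ts) P (X t @^-1` A t))%E.

Definition identically_distributed (P : probability T R)
    (X : nat -> {mfun T >-> T'}) : Prop :=
  forall (t : nat) (A : set T'), measurable A ->
    distribution P (X t) A = distribution P (X 0%N) A.

Definition iid (P : probability T R) (X : nat -> {mfun T >-> T'}) : Prop :=
  mutually_independent P X /\ identically_distributed P X.

End iid.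

(** [(delta(t), p(t))] *)
Notation disturbance R n := (n.-tuple R * n.-tuple R)%type.

(** [(s(t), (delta(t), p(t)))] *)
Notation observation R n := (n.-tuple R * (n.-tuple R * n.-tuple R))%type.

(** [cost i r p] is the cost [g_i(r; p)].  [Fmax i j] is only meaningful as a
    capacity when [i] and [j] are joined by a line: otherwise [flw i j] is
    forced to 0 by the power-flow equation. *)
Record network (R : realType) (n : nat) := Network {
  line : rel 'I_n ;
  Badm : 'M[R]_n ;
  Fmax : 'M[R]_n ;
  lambda : 'I_n -> R ;
  Smin : 'I_n -> R ;
  Smax : 'I_n -> R ;
  Umin : 'I_n -> R ;
  Umax : 'I_n -> R ;
  dmin : 'I_n -> R ;
  dmax : 'I_n -> R ;
  Pmin : 'I_n -> R ;
  Pmax : 'I_n -> R ;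
  cost : 'I_n -> R -> R -> R ;
  sinit : n.-tuple R
}.

(** The decision variables [u, r, theta, f] of one period. *)
Record decision (R : realType) (n : nat) := Decision {
  ctl : 'I_n -> R ;
  gen : 'I_n -> R ;
  ang : 'I_n -> R ;
  flw : 'I_n -> 'I_n -> R
}.

(** The information at index [t] is everything observed at indices
    [0, ..., t], the last component being the current observation. *)
Definition policy (R : realType) (n : nat) :=
  forall t : nat, t.+1.-tuple (observation R n) -> decision R n.

Section network_definitions.
Context (R : realType) (n : nat) (N : network R n).

Definition price_range (p : n.-tuple R) : Prop :=
  forall i, Pmin N i <= tnth p i <= Pmax N i.

Record network_assumptions : Prop := NetworkAssumptions {
  line_sym : symmetric (line N) ;
  line_irrefl : irreflexive (line N) ;
  Badm_sym : (Badm N)^T = Badm N ;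
  Badm_line : forall i j, i != j -> ~~ line N i j -> Badm N i j = 0 ;
  Fmax_line : forall i j, line N i j ->
    0 < Fmax N i j /\ Fmax N i j = Fmax N j i ;
  lambda_range : forall i, 0 < lambda N i <= 1 ;
  S_le : forall i, Smin N i <= Smax N i ;
  U_le : forall i, Umin N i <= Umax N i ;
  cost_convex : forall i p, Pmin N i <= p <= Pmax N i ->
    convex_function setT (fun r : R^o => cost N i r p : R^o) ;
  sinit_range : forall i, Smin N i <= tnth (sinit N) i <= Smax N i ;
  frequent_acting : forall i, Umax N i - Umin N i < Smax N i - Smin N i ;
  feasibility : forall i,
    lambda N i * Smin N i + Umax N i >= Smin N i /\
    lambda N i * Smax N i + Umin N i <= Smax N i ;
  controllability : forall i,
    lambda N i * Smax N i + Umax N i >= Smax N i /\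
    lambda N i * Smin N i + Umin N i <= Smin N i
}.

Definition flow_set : set ('I_n -> 'I_n -> R) :=
  [set f | forall i j, - Fmax N i j <= f i j <= Fmax N i j].

(** [phi_i(u_i, y_i)] with [y_i = (f, delta_i, p_i)] *)
Definition phi (i : 'I_n) (u : R) (f : 'I_n -> 'I_n -> R) (dl p : R) : R :=
  cost N i (u - dl + \sum_(j < n) f i j) p.

Definition subdifferential (h : R -> R) (u : R) : set R :=
  [set a | forall u', h u' >= h u + a * (u' - u)].

Definition Dg (i : 'I_n) : set R :=
  [set a | exists u f dl p,
    [/\ Umin N i <= u <= Umax N i, flow_set f,
        dmin N i <= dl <= dmax N i, Pmin N i <= p <= Pmax N i &
        subdifferential (fun u' => phi i u' f dl p) u a]].

Definition Dg_bounds (i : 'I_n) (Dlo Dhi : R) : Prop :=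
  [/\ Dlo < Dhi,
      (Dlo%:E <= ereal_inf (EFin @` Dg i))%E &
      (ereal_sup (EFin @` Dg i) <= Dhi%:E)%E].

Definition Gamma_min (i : 'I_n) (W Dlo : R) : R :=
  (lambda N i)^-1 * (- W * Dlo + Umax N i - Smax N i).

Definition Gamma_max (i : 'I_n) (W Dhi : R) : R :=
  (lambda N i)^-1 * (- W * Dhi - Smin N i + Umin N i).

Definition W_max (i : 'I_n) (Dlo Dhi : R) : R :=
  ((Smax N i - Smin N i) - (Umax N i - Umin N i)) / (Dhi - Dlo).

Definition Mu (i : 'I_n) (Gamma : R) : R :=
  2^-1 * Num.max ((Umin N i + (1 - lambda N i) * Gamma) ^+ 2)
                 ((Umax N i + (1 - lambda N i) * Gamma) ^+ 2).

Definition Ms (i : 'I_n) (Gamma : R) : R :=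
  Num.max ((Smin N i + Gamma) ^+ 2) ((Smax N i + Gamma) ^+ 2).

Definition Mi (i : 'I_n) (Gamma : R) : R :=
  Mu i Gamma + lambda N i * (1 - lambda N i) * Ms i Gamma.

(** The constraints shared by (P) and the one-period problem. *)
Definition period_constraints (dl : n.-tuple R) (x : decision R n) : Prop :=
  [/\ forall i, Umin N i <= ctl x i <= Umax N i,
      forall i, tnth dl i + gen x i = ctl x i + \sum_(j < n) flw x i j,
      forall i j, Badm N i j * (ang x i - ang x j) = flw x i j &
      forall i j, - Fmax N i j <= flw x i j <= Fmax N i j].

Definition stage_cost (p : n.-tuple R) (x : decision R n) : R :=
  \sum_(i < n) cost N i (gen x i) (tnth p i).

Definition online_objective (Gamma W : 'I_n -> R) (s p : n.-tuple R)
    (x : decision R n) : R :=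
  \sum_(i < n) (lambda N i / W i * (tnth s i + Gamma i) * ctl x i
                + cost N i (gen x i) (tnth p i)).

Definition online_optimal (Gamma W : 'I_n -> R) (s dl p : n.-tuple R)
    (x : decision R n) : Prop :=
  period_constraints dl x /\
  forall x', period_constraints dl x' ->
    online_objective Gamma W s p x <= online_objective Gamma W s p x'.

Definition next_storage (s : n.-tuple R) (x : decision R n) : n.-tuple R :=
  [tuple lambda N i * tnth s i + ctl x i | i < n].

Definition policy_measurable (pol : policy R n) : Prop :=
  forall t i,
    [/\ measurable_fun setT (fun h => ctl (pol t h) i),
        measurable_fun setT (fun h => gen (pol t h) i),
        measurable_fun setT (fun h => ang (pol t h) i) &
        forall j, measurable_fun setT (fun h => flw (pol t h) i j)].

Context d (T : measurableType d) (P : probability T R).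
Context (y : nat -> {mfun T >-> disturbance R n}).

Definition disturbance_range : Prop := forall t w i,
  dmin N i <= tnth (y t w).1 i <= dmax N i /\
  Pmin N i <= tnth (y t w).2 i <= Pmax N i.

Fixpoint info (pol : policy R n) (w : T) (t : nat) :
    t.+1.-tuple (observation R n) :=
  match t with
  | 0 => [tuple (sinit N, y 0%N w)]
  | t'.+1 =>
    let h := info pol w t' in
    rcons_tuple h (next_storage (tnth h ord_max).1 (pol t' h), y t'.+1 w)
  end.

Definition storage (pol : policy R n) (w : T) (t : nat) : n.-tuple R :=
  (tnth (info pol w t) ord_max).1.

Definition decide (pol : policy R n) (w : T) (t : nat) : decision R n :=
  pol t (info pol w t).

Definition feasible (pol : policy R n) : Prop := forall w t,
  [/\ period_constraints (y t w).1 (decide pol w t),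
      forall i, tnth (storage pol w t.+1) i =
        lambda N i * tnth (storage pol w t) i + ctl (decide pol w t) i &
      forall i, Smin N i <= tnth (storage pol w t) i <= Smax N i].

Definition average_cost (pol : policy R n) (m : nat) : R :=
  m%:R^-1 *
  fine ('E_P[(fun w => \sum_(t < m) stage_cost (y t w).2 (decide pol w t))%R]%E).

Definition J (pol : policy R n) : R := limn (average_cost pol).

(** The limit and expectations in [J pol] exist.  Since nothing is assumed on
    how [cost] depends on the price, measurability of the cost of a period, as
    a function of the information, is part of the existence of its
    expectation. *)
Definition cost_exists (pol : policy R n) : Prop :=
  [/\ forall t, measurable_fun
        [set h : t.+1.-tuple (observation R n) |
          price_range (tnth h ord_max).2.2]
        (fun h => stage_cost (tnth h ord_max).2.2 (pol t h)),
      forall t, P.-integrable setT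
        (fun w => (stage_cost (y t w).2 (decide pol w t))%:E) &
      cvgn (average_cost pol)].

Definition admissible (pol : policy R n) : Prop :=
  policy_measurable pol /\ cost_exists pol.

(** The infimum, whether or not it is attained. *)
Definition Jstar : R :=
  inf [set J pol | pol in [set pol | admissible pol /\ feasible pol]].

Definition OMG (Gamma W : 'I_n -> R) (pol : policy R n) : Prop := forall w t,
  online_optimal Gamma W (storage pol w t) (y t w).1 (y t w).2 (decide pol w t).

End network_definitions.

(* Main.v *)
(** Drift-plus-penalty argument.  Storage bounds: all subgradients of the stage
    cost in [u_i] lie between [Dlo i] and [Dhi i], so the one-period optimum
    takes [u_i = Umin] as soon as [lambda (s + Gamma) > - W Dlo] and
    [u_i = Umax] as soon as [lambda (s + Gamma) < - W Dhi]; the bounds on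
    [Gamma] say that one of these holds whenever the storage level could leave
    its range.

    Cost: let [pol] be any feasible policy.  At each time [t] the online decision
    is at least as good as the decision that [pol] takes at any time [k] on the
    current disturbance and an independent copy of the past.  Because the current
    disturbance is independent of the storage level, the expected online objective
    at [t] is at most the sum over [i] of
    [lambda / W * E (s_i(t) + Gamma) * E u_i^pol(k)] plus the expected cost of
    [pol] at [k].  Averaged over [k], [E u_i^pol] is [1 - lambda] times the average
    storage level of [pol], up to O(1/m).  Adding the drift of
    [(s + Gamma)^2 / (2 W)] and averaging over [t] gives the bound [sum Mi / W]
    up to O(1/m). *)

Require Import Defs.
From HB Require Import structures.
From mathcomp Require Import all_boot all_order all_algebra.
From mathcomp Require Import ring lra.
From mathcomp Require Import all_classical all_reals all_analysis.
From mathcomp Require Import measurable_realfun.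
Set Implicit Arguments.
Unset Strict Implicit.
Unset Printing Implicit Defensive.
Import Order.TTheory GRing.Theory Num.Theory numFieldNormedType.Exports.
Local Open Scope classical_set_scope.
Local Open Scope ring_scope.

(** * Subgradients and storage bounds *)

Lemma convex_functionR (R : realType) (h : R -> R) :
  convex_function setT (h : R^o -> R^o) ->
  forall t x y, 0 <= t <= 1 ->
    h (t * x + (1 - t) * y) <= t * h x + (1 - t) * h y.
Proof.
move=> hc t x y /andP[t0 t1].
exact: (hc (Itv01 t0 t1) x y (in_setT _) (in_setT _)).
Qed.

Section subgradient.
Context (R : realType) (h : R -> R).
Hypothesis h_convex : forall t x y, 0 <= t <= 1 ->
  h (t * x + (1 - t) * y) <= t * h x + (1 - t) * h y.

(** Slopes of a convex function increase: this compares the left and right slopes at [u], with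
    denominators cleared. The weight of [z] in [u], as a convex combination of [z] and [x], is
    [(x - u) / (x - z)]. *)
Lemma convex_chord (z u x : R) : z < u -> u < x ->
  (h u - h z) * (x - u) <= (h x - h u) * (u - z).
Proof.
move=> zu ux; have xz : 0 < x - z by lra.
have t01 : 0 <= (x - u) / (x - z) <= 1.
  by rewrite divr_ge0 /= ?ler_pdivrMr //; lra.
have := h_convex z x t01.
have -> : (x - u) / (x - z) * z + (1 - (x - u) / (x - z)) * x = u.
  by field; lra.
rewrite -(ler_pM2l xz).
have -> : (x - z) * ((x - u) / (x - z) * h z + (1 - (x - u) / (x - z)) * h x)
  = (x - u) * h z + (u - z) * h x by field; lra.
lra.
Qed.

(** The supremum of the left slopes at [u] is a subgradient: it dominates every left slope, and
    every right slope is an upper bound of the left ones. *)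
Lemma convex_subgradient (u : R) : subdifferential h u !=set0.
Proof.
pose S := [set (h u - h z) / (u - z) | z in [set z | z < u]].
have S0 : S !=set0 by exists ((h u - h (u - 1)) / (u - (u - 1))), (u - 1) => //=; lra.
have Sub (x : R) : u < x -> ubound S ((h x - h u) / (x - u)).
  move=> ux _ [z /= zu <-].
  rewrite ler_pdivrMr ?subr_gt0// mulrAC ler_pdivlMr ?subr_gt0//.
  exact: convex_chord.
exists (sup S) => x.
have [xu|ux|->] := ltgtP x u; last by lra.
(* The slope to [u + 1] bounds [S] above, so that [sup S] is a genuine supremum. *)
- have : (h u - h x) / (u - x) <= sup S.
    by apply: ub_le_sup; [exists ((h (u + 1) - h u) / (u + 1 - u)); apply: Sub; lra|exists x].
  by rewrite ler_pdivrMr ?subr_gt0//; lra.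
- have := ge_sup S0 (Sub x ux); rewrite ler_pdivlMr ?subr_gt0//; lra.
Qed.

End subgradient.

Section online_storage.
Context (R : realType) (n : nat) (N : network R n).
Hypothesis hN : network_assumptions N.

Lemma phi_convex i f dl p : Pmin N i <= p <= Pmax N i ->
  forall t x y, 0 <= t <= 1 ->
    phi N i (t * x + (1 - t) * y) f dl p
    <= t * phi N i x f dl p + (1 - t) * phi N i y f dl p.
Proof.
move=> hp t x y ht; rewrite /phi.
apply: le_trans (convex_functionR (cost_convex hN hp) _ _ ht).
by rewrite le_eqVlt; apply/orP; left; apply/eqP; congr (cost N i _ p); ring.
Qed.

Lemma Dg_subgradient i (u : R) f dl p : Umin N i <= u <= Umax N i ->
  flow_set N f -> dmin N i <= dl <= dmax N i -> Pmin N i <= p <= Pmax N i ->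
  exists2 a, Dg N i a & forall u',
    phi N i u' f dl p >= phi N i u f dl p + a * (u' - u).
Proof.
move=> hu hf hdl hp; have [a ha] := convex_subgradient (phi_convex f dl hp) u.
by exists a => //; exists u, f, dl, p.
Qed.

Lemma Dg_boundsP i Dlo Dhi a : Dg_bounds N i Dlo Dhi -> Dg N i a ->
  Dlo <= a <= Dhi.
Proof.
move=> [_ lo hi] Da; rewrite -!lee_fin; apply/andP; split.
  by apply: le_trans lo _; apply: ereal_inf_lbound; exists a.
by apply: le_trans _ hi; apply: ereal_sup_ubound; exists a.
Qed.

(* Conventional generation absorbs the change of control, so that the power
   balance still holds. *)
Definition deviate (x : decision R n) (i : 'I_n) (v : R) : decision R n :=
  Decision (fun k => if k == i then v else ctl x k)
    (fun k => if k == i then gen x k + (v - ctl x k) else gen x k)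
    (ang x) (flw x).

Lemma deviate_constraints dl x i v : period_constraints N dl x ->
  Umin N i <= v <= Umax N i -> period_constraints N dl (deviate x i v).
Proof.
move=> [hu hb ha hf] hv; split => //= k; case: eqP => [->|_] //.
by rewrite addrA hb; ring.
Qed.

(** Compare the optimum with [deviate x i v]: angles and flows are unchanged, so all terms of the
    other buses cancel, and the power balance identifies the two generation costs at [i] with values
    of [phi]. *)
Lemma online_optimal_deviation Gamma W s dl p x i v :
  online_optimal N Gamma W s dl p x -> Umin N i <= v <= Umax N i ->
  lambda N i / W i * (tnth s i + Gamma i) * (ctl x i - v) <=
  phi N i v (flw x) (tnth dl i) (tnth p i)
  - phi N i (ctl x i) (flw x) (tnth dl i) (tnth p i).
Proof.
move=> [hx hopt] hv; have := hopt _ (deviate_constraints hx hv).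
rewrite /online_objective (bigD1 i) //= [X in _ <= X](bigD1 i) //= eqxx.
under [X in _ <= _ + X]eq_bigr => k /negPf ki do rewrite ki.
rewrite lerD2r /phi; have [_ hb _ _] := hx; have := hb i => {}hb.
have -> : ctl x i - tnth dl i + \sum_(j < n) flw x i j = gen x i by lra.
have -> : v - tnth dl i + \sum_(j < n) flw x i j = gen x i + (v - ctl x i) by lra.
lra.
Qed.

Section one_period.
Context (Dlo Dhi Gamma W : 'I_n -> R) (s dl p : n.-tuple R) (x : decision R n).
Context (i : 'I_n).
Hypotheses (hD : Dg_bounds N i (Dlo i) (Dhi i)) (W_gt0 : 0 < W i).
Hypothesis dl_range : dmin N i <= tnth dl i <= dmax N i.
Hypothesis p_range : Pmin N i <= tnth p i <= Pmax N i.
Hypothesis hx : online_optimal N Gamma W s dl p x.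

(** Let [c] be the storage weight and [a] a subgradient of [phi] at [Umin]. Deviating to [Umin]
    gives [(c + a) * (ctl x i - Umin N i) <= 0], while [c > - Dlo i] and [a >= Dlo i] make the first
    factor positive; hence the control cannot exceed [Umin]. *)
Lemma online_ctl_min :
  - W i * Dlo i < lambda N i * (tnth s i + Gamma i) -> ctl x i = Umin N i.
Proof.
move=> hs; have [[hu _ _ hf] _] := hx; have hUi := hu i.
apply/eqP/contraT => neq.
have hlt : Umin N i < ctl x i by rewrite lt_neqAle eq_sym neq; case/andP: hUi.
have hv : Umin N i <= Umin N i <= Umax N i by rewrite lexx (U_le hN).
have := online_optimal_deviation hx hv.
have [a Da /(_ (ctl x i)) ha] := Dg_subgradient hv hf dl_range p_range.
have /andP[loa _] := Dg_boundsP hD Da.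
have hW : lambda N i / W i * (tnth s i + Gamma i) =
  lambda N i * (tnth s i + Gamma i) / W i by rewrite mulrAC.
have : - Dlo i < lambda N i / W i * (tnth s i + Gamma i).
  by rewrite hW ltr_pdivlMr //; lra.
set c := lambda N i / W i * _ => hc hdev.
have : (c + a) * (ctl x i - Umin N i) <= 0 by lra.
by rewrite pmulr_lle0 ?subr_gt0 //; lra.
Qed.

(** Mirror argument, with a subgradient at [Umax] and the bound [a <= Dhi i]. *)
Lemma online_ctl_max :
  lambda N i * (tnth s i + Gamma i) < - W i * Dhi i -> ctl x i = Umax N i.
Proof.
move=> hs; have [[hu _ _ hf] _] := hx; have hUi := hu i.
apply/eqP/contraT => neq.
have hlt : ctl x i < Umax N i by rewrite lt_neqAle neq; case/andP: hUi.
have hv : Umin N i <= Umax N i <= Umax N i by rewrite lexx (U_le hN).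
have := online_optimal_deviation hx hv.
have [a Da /(_ (ctl x i)) ha] := Dg_subgradient hv hf dl_range p_range.
have /andP[_ ahi] := Dg_boundsP hD Da.
have hW : lambda N i / W i * (tnth s i + Gamma i) =
  lambda N i * (tnth s i + Gamma i) / W i by rewrite mulrAC.
have : lambda N i / W i * (tnth s i + Gamma i) < - Dhi i.
  by rewrite hW ltr_pdivrMr //; lra.
set c := lambda N i / W i * _ => hc hdev.
have : 0 <= (c + a) * (Umax N i - ctl x i) by lra.
by rewrite pmulr_lge0 ?subr_gt0 //; lra.
Qed.

(** If even the control [Umin] keeps the level above [Smin], the lower bound is immediate. Otherwise
    [Gamma <= Gamma_max] puts the weight below [- W * Dhi], the control is [Umax], and feasibility
    of the storage parameters gives the bound. The upper bound is symmetric. *)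
Lemma online_next_storage_range :
  Gamma_min N i (W i) (Dlo i) <= Gamma i <= Gamma_max N i (W i) (Dhi i) ->
  Smin N i <= tnth s i <= Smax N i ->
  Smin N i <= lambda N i * tnth s i + ctl x i <= Smax N i.
Proof.
move=> /andP[]; rewrite /Gamma_min /Gamma_max.
have /andP[l0 l1] := lambda_range hN i.
rewrite ler_pdivrMl // ler_pdivlMl // => hmin hmax /andP[s1 s2].
have [[hu _ _ _] _] := hx; have /andP[u1 u2] := hu i.
have [f1 f2] := feasibility hN i.
have ls1 : lambda N i * Smin N i <= lambda N i * tnth s i by rewrite ler_pM2l.
have ls2 : lambda N i * tnth s i <= lambda N i * Smax N i by rewrite ler_pM2l.
apply/andP; split.
  have [|hlt] := leP (Smin N i) (lambda N i * tnth s i + Umin N i); first by lra.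
  by rewrite online_ctl_max; lra.
have [|hlt] := leP (lambda N i * tnth s i + Umax N i) (Smax N i); first by lra.
by rewrite online_ctl_min; lra.
Qed.

End one_period.

End online_storage.

(** * Change of variables between maps with the same law *)

Section change_of_variables.
Context d1 d2 d3 (T1 : measurableType d1) (T2 : measurableType d2)
  (S : measurableType d3) (R : realType).
Context (m1 : {measure set T1 -> \bar R}) (m2 : {measure set T2 -> \bar R}).
Context (f1 : T1 -> S) (f2 : T2 -> S).
Hypotheses (mf1 : measurable_fun setT f1) (mf2 : measurable_fun setT f2).
Hypothesis same_law : forall A, measurable A -> m1 (f1 @^-1` A) = m2 (f2 @^-1` A).
Context (F : S -> R).
Hypothesis mF : measurable_fun setT F.
Hypothesis intF : m1.-integrable setT (EFin \o (F \o f1)).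

(** The absolute value is transported through the common image measure; for nonnegative functions
    the change of variables presupposes no integrability. *)
Lemma integrable_same_law : m2.-integrable setT (EFin \o (F \o f2)).
Proof.
pose g1 : {mfun T1 >-> S} := HB.pack f1 (isMeasurableFun.Build _ _ _ _ _ mf1).
pose g2 : {mfun T2 >-> S} := HB.pack f2 (isMeasurableFun.Build _ _ _ _ _ mf2).
have mFE : measurable_fun setT (abse \o (EFin \o F) : S -> \bar R).
  by do 2 apply: measurableT_comp => //; exact: measurable_abse.
apply/integrableP; split.
  by apply: measurableT_comp => //; exact: measurableT_comp.
have := integrableP _ _ _ intF => -[_]; apply: le_lt_trans.
have E1 := @ge0_integral_pushforward _ _ _ _ R f1 mf1 m1 setT (abse \o (EFin \o F))
  measurableT mFE (fun _ _ => abse_ge0 _).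
have E2 := @ge0_integral_pushforward _ _ _ _ R f2 mf2 m2 setT (abse \o (EFin \o F))
  measurableT mFE (fun _ _ => abse_ge0 _).
rewrite !preimage_setT in E1 E2; rewrite -[leRHS]E1 -[leLHS]E2.
rewrite le_eqVlt; apply/orP; left; apply/eqP.
apply: (@eq_measure_integral _ _ _ _ (pushforward m1 g1) (pushforward m2 g2)).
by move=> A mA _; rewrite /= /pushforward -same_law.
Qed.

Lemma Rintegral_same_law :
  (\int[m1]_x F (f1 x) = \int[m2]_x F (f2 x))%R.
Proof.
pose g1 : {mfun T1 >-> S} := HB.pack f1 (isMeasurableFun.Build _ _ _ _ _ mf1).
pose g2 : {mfun T2 >-> S} := HB.pack f2 (isMeasurableFun.Build _ _ _ _ _ mf2).
have mFE : measurable_fun setT (EFin \o F) by exact: measurableT_comp.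
rewrite /Rintegral; congr fine.
have E1 := @integral_pushforward _ _ _ _ R f1 mf1 m1 setT _ mFE intF measurableT.
have E2 := @integral_pushforward _ _ _ _ R f2 mf2 m2 setT _ mFE
  integrable_same_law measurableT.
rewrite !preimage_setT in E1 E2; rewrite -[LHS]E1 -[RHS]E2.
apply: (@eq_measure_integral _ _ _ _ (pushforward m2 g2) (pushforward m1 g1)).
by move=> A mA _; exact: same_law.
Qed.

End change_of_variables.

(** * Independent copies of the current disturbance *)

(** A pi-system containing the whole space and independent of [X]: the form of independence that
    extends to the generated sigma-algebra. *)
Record independent_generator d d' (T : measurableType d)
    (Y : measurableType d') (R : realType) (P : probability T R)
    (G : set (set T)) (X : {mfun T >-> Y}) : Prop := IndependentGenerator {
  gen_measurable : G `<=` measurable ;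
  gen_setI : setI_closed G ;
  gen_setT : G setT ;
  gen_indep : forall A B, G A -> measurable B ->
    P (A `&` X @^-1` B) = (P A * P (X @^-1` B))%E
}.

Section independent_copy.
Context d d' (T : measurableType d) (Y : measurableType d') (R : realType).
Context (P : probability T R) (G : set (set T)) (X X' : {mfun T >-> Y}).
Hypothesis hG : independent_generator P G X.
Hypothesis X_law : forall B, measurable B -> P (X @^-1` B) = P (X' @^-1` B).

Let generated_measurable A : <<s G >> A -> measurable A.
Proof.
apply: smallest_sub; first exact: sigma_algebra_measurable.
exact: gen_measurable hG.
Qed.

(** For fixed [B], both sides are finite measures in [A] that agree on the pi-system [G], hence on
    the sigma-algebra it generates. *)
Lemma generated_indep A B : <<s G >> A -> measurable B ->
  P (A `&` X @^-1` B) = (P A * P (X @^-1` B))%E.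
Proof.
move=> GA mB.
have mXB : measurable (X @^-1` B) by exact: measurable_funPTI.
have PXB : P (X @^-1` B) = (fine (P (X @^-1` B)))%:E.
  by rewrite fineK // fin_num_measure.
pose r := NngNum (fine_ge0 (measure_ge0 P (X @^-1` B))).
transitivity (mscale r P A); last by rewrite /mscale /= -PXB muleC.
apply: (g_sigma_algebra_measure_unique G (gen_measurable hG) (fun=> setT)
  (fun=> gen_setT hG) _ (mrestr P mXB) (mscale r P)) => //.
- by rewrite bigcup_const.
- exact: gen_setI hG.
- move=> C GC; transitivity (P C * P (X @^-1` B))%E; first exact: gen_indep hG _ _ _ _.
  by rewrite /= /mscale /= -PXB muleC.
- move=> k; apply: le_lt_trans (ltry 1); rewrite /= /mrestr setTI.
  exact: probability_le1.
Qed.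

Local Notation past := (g_sigma_algebraType G).

Lemma measurable_to_past : measurable_fun setT (id : T -> past).
Proof. by move=> _ A mA; rewrite setTI; exact: generated_measurable. Qed.

Lemma measurable_past_pair :
  measurable_fun setT (fun w => (w, X w) : past * Y).
Proof.
by apply: measurable_fun_pair; [exact: measurable_to_past|exact: measurable_funPT].
Qed.

Lemma measurable_past_copy :
  measurable_fun setT (fun z : T * T => (z.1, X' z.2) : past * Y).
Proof.
apply: measurable_fun_pair.
  exact: (measurableT_comp measurable_to_past measurable_fst).
exact: (measurableT_comp (measurable_funPT X') measurable_snd).
Qed.

(** Seen through the sigma-algebra of [G], the outcome is independent of [X]. Both image measures
    therefore have product values on rectangles, which determines them. *)
Lemma independent_copy_law (S : set (past * Y)%type) : measurable S ->
  P ((fun w => (w, X w)) @^-1` S) = (P \x P)%E ((fun z => (z.1, X' z.2)) @^-1` S).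
Proof.
move=> mS.
pose idm : {mfun T >-> past} :=
  HB.pack (id : T -> past) (isMeasurableFun.Build _ _ _ _ _ measurable_to_past).
pose f1 : {mfun T >-> (past * Y)%type} :=
  HB.pack (fun w => (w, X w) : past * Y)
    (isMeasurableFun.Build _ _ _ _ _ measurable_past_pair).
pose f2 : {mfun (T * T)%type >-> (past * Y)%type} :=
  HB.pack (fun z : T * T => (z.1, X' z.2) : past * Y)
    (isMeasurableFun.Build _ _ _ _ _ measurable_past_copy).
have E1 := @product_measure_unique _ _ _ _ R (distribution P idm) (distribution P X')
  (pushforward P f1).
have E2 := @product_measure_unique _ _ _ _ R (distribution P idm) (distribution P X')
  (pushforward (P \x P)%E f2).
transitivity ((distribution P idm \x distribution P X')%E S).
- rewrite E1 // => A B mA mB.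
  transitivity (P A * P (X @^-1` B))%E; first exact: generated_indep.
  by rewrite X_law.
- rewrite E2 // => A B mA mB.
  transitivity ((P \x P)%E (A `*` (X' @^-1` B))) => //.
  rewrite product_measure1E //; first exact: generated_measurable.
  exact: measurable_funPTI.
Qed.

Lemma independent_copy_integrable (F : past * Y -> R) :
  measurable_fun setT F -> P.-integrable setT (fun w => (F (w, X w))%:E) ->
  (P \x P)%E.-integrable setT (fun z => (F (z.1, X' z.2))%:E).
Proof.
move=> mF intF.
exact: (integrable_same_law measurable_past_pair measurable_past_copy
  independent_copy_law mF intF).
Qed.

Lemma independent_copy_integral (F : past * Y -> R) :
  measurable_fun setT F -> P.-integrable setT (fun w => (F (w, X w))%:E) ->
  \int[P]_w F (w, X w) = \int[(P \x P)%E]_z F (z.1, X' z.2).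
Proof.
move=> mF intF.
exact: (Rintegral_same_law measurable_past_pair measurable_past_copy
  independent_copy_law mF intF).
Qed.

End independent_copy.

(** * Integrals of bounded functions and integrals on products *)

Lemma bounded_integrable d (T : measurableType d) (R : realType)
  (mu : probability T R)
  (f : T -> R) (C : R) : measurable_fun setT f -> (forall x, `|f x| <= C) ->
  mu.-integrable setT (fun x => (f x)%:E).
Proof.
move=> mf hC; apply: measurable_bounded_integrable => //.
  exact: le_lt_trans (probability_le1 mu measurableT) (ltry 1).
by exists C; split => [|M CM x _]; [exact: num_real|exact: le_trans (hC x) (ltW CM)].
Qed.

(** Serves the comparison on the product space, where the competing decision meets the constraints
    only outside a null set. *)
Lemma le_Rintegral_null d (T : measurableType d) (R : realType)
  (mu : {measure set T -> \bar R}) (A : set T) (f g : T -> R) :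
  mu.-integrable setT (fun x => (f x)%:E) ->
  mu.-integrable setT (fun x => (g x)%:E) ->
  measurable A -> mu A = 0%E -> (forall x, ~ A x -> f x <= g x) ->
  \int[mu]_x f x <= \int[mu]_x g x.
Proof.
move=> intf intg mA A0 fg.
rewrite /Rintegral !(negligible_integral mA measurableT _ A0) // -!/(Rintegral _ _ _).
have mD : measurable (setT `\` A) by exact: measurableD.
apply: le_Rintegral => //; last by move=> x [_]; exact: fg.
- exact: integrableS intf.
- exact: integrableS intg.
Qed.

Section product_integrals.
Context d1 d2 (T1 : measurableType d1) (T2 : measurableType d2) (R : realType).
Context (P : probability T1 R) (Q : probability T2 R).

Let inner_fin_num (f : T1 * T2 -> R) (C : R) (x : T1) :
  measurable_fun setT f -> (forall z, `|f z| <= C) ->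
  (\int[Q]_y (f (x, y))%:E)%E \is a fin_num.
Proof.
move=> mf hC; apply: integrable_fin_num => //.
apply: (@bounded_integrable _ _ _ _ (fun y => f (x, y)) C) => //.
by apply: (measurableT_comp mf); exact: measurable_fun_pair.
Qed.

Lemma Rintegral_prod_integrable (f : T1 * T2 -> R) (C : R) :
  measurable_fun setT f -> (forall z, `|f z| <= C) ->
  P.-integrable setT (fun x => (\int[Q]_y f (x, y))%:E).
Proof.
move=> mf hC.
have := integrable_fubini_F (@bounded_integrable _ _ _ (P \x Q)%E f C mf hC).
apply: eq_integrable => // x _.
by rewrite /fubini_F /Rintegral fineK //; exact: inner_fin_num mf hC.
Qed.

Lemma Rintegral_prod (f : T1 * T2 -> R) (C : R) :
  measurable_fun setT f -> (forall z, `|f z| <= C) ->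
  \int[(P \x Q)%E]_z f z = \int[P]_x \int[Q]_y f (x, y).
Proof.
move=> mf hC; rewrite /Rintegral; congr fine.
rewrite -integral12_prod_meas1; last exact: bounded_integrable mf hC.
apply: eq_integral => x _.
by rewrite /fubini_F fineK //; exact: inner_fin_num mf hC.
Qed.

Lemma Rintegral_prod_mul (c : T1 -> R) (h : T2 -> R) (C C' : R) :
  measurable_fun setT c -> measurable_fun setT h ->
  (forall x, `|c x| <= C) -> (forall y, `|h y| <= C') ->
  \int[(P \x Q)%E]_z (c z.1 * h z.2) = \int[P]_x c x * \int[Q]_y h y.
Proof.
move=> mc mh hC hC'.
rewrite (@Rintegral_prod (fun z => c z.1 * h z.2) (C * C')) /=; last 2 first.
- apply: measurable_funM; first exact: (measurableT_comp mc).
  exact: (measurableT_comp mh).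
- by move=> z; rewrite normrM ler_pM.
transitivity (\int[P]_x (c x * \int[Q]_y h y)).
  apply: eq_Rintegral => x _; rewrite RintegralZl //.
  exact: bounded_integrable mh hC'.
by rewrite RintegralZr //; exact: bounded_integrable mc hC.
Qed.

Let snd_law (A : set T2) : measurable A ->
  Q (id @^-1` A) = (P \x Q)%E (snd @^-1` A).
Proof.
move=> mA; have -> : snd @^-1` A = setT `*` A :> set (T1 * T2).
  by apply/seteqP; split => [z|z []].
transitivity (P setT * Q A)%E; last by rewrite product_measure1E.
by rewrite (probability_setT P) mul1e.
Qed.

Lemma integrable_snd (f : T2 -> R) : measurable_fun setT f ->
  Q.-integrable setT (fun x => (f x)%:E) ->
  (P \x Q)%E.-integrable setT (fun z => (f z.2)%:E).
Proof.
exact: (integrable_same_law (@measurable_id _ _ setT) measurable_snd snd_law).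
Qed.

Lemma Rintegral_snd (f : T2 -> R) : measurable_fun setT f ->
  Q.-integrable setT (fun x => (f x)%:E) ->
  \int[(P \x Q)%E]_z f z.2 = \int[Q]_y f y.
Proof.
move=> mf intf; apply/esym.
exact: (Rintegral_same_law (@measurable_id _ _ setT) measurable_snd snd_law mf intf).
Qed.

End product_integrals.

Section cross_independence.
Context d d' (T : measurableType d) (Y : measurableType d') (R : realType).
Context (P : probability T R).

(** Replacing [X] by an independent copy turns the integrand into a product of functions of separate
    coordinates. *)
Lemma independent_mul (G : set (set T)) (X : {mfun T >-> Y})
  (c : T -> R) (h : Y -> R) (C C' : R) : independent_generator P G X ->
  measurable_fun (setT : set (g_sigma_algebraType G)) c ->
  measurable_fun setT h ->
  (forall w, `|c w| <= C) -> (forall v, `|h v| <= C') ->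
  \int[P]_w (c w * h (X w)) = \int[P]_w c w * \int[P]_w h (X w).
Proof.
move=> hG mc mh hC hC'.
have mcT : measurable_fun setT c := measurableT_comp mc (measurable_to_past hG).
have mhX : measurable_fun setT (h \o X) by exact: measurableT_comp.
pose F (z : g_sigma_algebraType G * Y) := c z.1 * h z.2.
have mF : measurable_fun setT F.
  apply: measurable_funM; first exact: (measurableT_comp mc measurable_fst).
  exact: (measurableT_comp mh measurable_snd).
rewrite (independent_copy_integral hG (fun=> fun=> erefl) mF).
  exact: (Rintegral_prod_mul P P mcT mhX hC (fun w => hC' (X w))).
apply: (@bounded_integrable _ _ _ _ _ (C * C')).
  exact: measurable_funM.
by move=> w; rewrite /F normrM ler_pM.
Qed.

(** This separates the online storage level [c] from the competitor's control [U], which acts on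
    another past but on the same current disturbance [X]. Once the first coordinate is frozen, [c]
    is independent of [X] and factors out; what is left is the expectation of [U] on an independent
    copy, equal to its expectation along [X']. *)
Lemma cross_mul (G G' : set (set T)) (X X' : {mfun T >-> Y})
  (c : T -> R) (U : T * Y -> R) (C C' : R) :
  independent_generator P G X -> independent_generator P G' X' ->
  (forall B, measurable B -> P (X @^-1` B) = P (X' @^-1` B)) ->
  measurable_fun (setT : set (g_sigma_algebraType G)) c ->
  measurable_fun (setT : set (g_sigma_algebraType G' * Y)%type) U ->
  (forall w, `|c w| <= C) -> (forall z, `|U z| <= C') ->
  \int[(P \x P)%E]_z (c z.2 * U (z.1, X z.2)) =
  \int[P]_w c w * \int[P]_w U (w, X' w).
Proof.
move=> hG hG' law mc mU hC hC'.
have law' B : measurable B -> P (X' @^-1` B) = P (X @^-1` B).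
  by move=> mB; rewrite law.
have mcT : measurable_fun setT c := measurableT_comp mc (measurable_to_past hG).
have mUT : measurable_fun (setT : set (T * Y)%type) U.
  have mJ : measurable_fun setT
      (fun z : T * Y => (z.1, z.2) : g_sigma_algebraType G' * Y).
    apply: measurable_fun_pair => //.
    exact: (measurableT_comp (measurable_to_past hG') measurable_fst).
  rewrite (_ : U = U \o (fun z : T * Y => (z.1, z.2) : g_sigma_algebraType G' * Y)).
    exact: measurableT_comp mU mJ.
  by apply/funext => -[].
have mUX : measurable_fun (setT : set (T * T)%type) (fun z => U (z.1, X z.2)).
  apply: (measurableT_comp mUT); apply: measurable_fun_pair => //.
  exact: (measurableT_comp (measurable_funPT X) measurable_snd).
have mUw w : measurable_fun setT (fun v => U (w, v)).
  by apply: (measurableT_comp mUT); exact: measurable_fun_pair.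
rewrite (@Rintegral_prod _ _ _ _ _ _ _ (fun z => c z.2 * U (z.1, X z.2)) (C * C')).
- transitivity (\int[P]_w (\int[P]_w c w * \int[P]_w' U (w, X w'))).
    apply: eq_Rintegral => w _ /=.
    exact: (independent_mul hG mc (mUw w) hC (fun v => hC' (w, v))).
  (* The right side is also moved to the product space, with [X] as the copy of [X']. *)
  rewrite (independent_copy_integral hG' law' mU); last first.
    apply: (@bounded_integrable _ _ _ _ _ C') => //.
    apply: (measurableT_comp mUT); exact: measurable_fun_pair.
  rewrite (@Rintegral_prod _ _ _ _ _ _ _ (fun z => U (z.1, X z.2)) C') //.
  rewrite RintegralZl //.
  exact: (@Rintegral_prod_integrable _ _ _ _ _ _ _ (fun z => U (z.1, X z.2)) C').
- apply: measurable_funM => //; exact: (measurableT_comp mcT measurable_snd).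
- by move=> z; rewrite normrM ler_pM.
Qed.

End cross_independence.

(** * Information and past events *)

Section past.
Context d d' (T : measurableType d) (Y : measurableType d') (R : realType).
Context (P : probability T R) (y : nat -> {mfun T >-> Y}).

(** Cylinder events on the disturbances strictly before [t]. Taking only cylinders makes the family
    a pi-system on which mutual independence applies directly. *)
Definition past_events (t : nat) : set (set T) :=
  [set \big[setI/setT]_(k <- iota 0 t) (y k @^-1` A k)
     | A in [set A : nat -> set Y | forall k, measurable (A k)]].

Definition past (t : nat) := g_sigma_algebraType (past_events t).

Lemma past_independent t : mutually_independent P y ->
  independent_generator P (past_events t) (y t).
Proof.
move=> hind; split.
- move=> _ [A mA <-]; apply: bigsetI_measurable => k _.
  exact: measurable_funPTI.
- move=> _ _ [A mA <-] [B mB <-]; exists (fun k => A k `&` B k).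
    by move=> k; exact: measurableI.
  rewrite -big_split; apply: eq_bigr => k _.
  by rewrite preimage_setI.
- exists (fun=> setT) => //; apply: big1 => k _; exact: preimage_setT.
- move=> _ B [A mA <-] mB.
  (* Prescribing [B] at index [t] makes the intersection an event on the indices [0, ..., t], to
     which the product formula applies. *)
  pose A' k := if k == t then B else A k.
  have mA' k : measurable (A' k) by rewrite /A'; case: eqP.
  have A't : A' t = B by rewrite /A' eqxx.
  have A'E k : k \in iota 0 t -> A' k = A k.
    by rewrite mem_iota /A' => /andP[_ kt]; rewrite ltn_eqF.
  have EA : \big[setI/setT]_(k <- iota 0 t) (y k @^-1` A' k) =
            \big[setI/setT]_(k <- iota 0 t) (y k @^-1` A k).
    by apply: eq_big_seq => k kt; rewrite A'E.
  have := hind _ A' (iota_uniq 0 t.+1) mA'.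
  rewrite -addn1 iotaD !big_cat !big_seq1 /= add0n EA A't => ->; congr (_ * _)%E.
  by rewrite -EA hind ?iota_uniq.
Qed.

Lemma measurable_past_obs t k : (k < t)%N ->
  measurable_fun (setT : set (past t)) (y k).
Proof.
move=> kt _ B mB; rewrite setTI; apply: sub_sigma_algebra => /=.
exists (fun j => if j == k then B else setT).
  by move=> j; case: eqP.
rewrite (bigD1_seq k) ?iota_uniq ?mem_iota //= eqxx big1 ?setIT // => j /negPf ->.
exact: preimage_setT.
Qed.

Lemma measurable_past_widen t : measurable_fun (setT : set (past t.+1)) (id : T -> past t).
Proof.
move=> _ B mB; rewrite setTI; move: B mB; apply: smallest_sub.
  exact: sigma_algebra_measurable.
move=> _ [A mA <-]; rewrite big_seq; apply: bigsetI_measurable => k.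
rewrite mem_iota => /andP[_ kt].
have := @measurable_past_obs t.+1 k (ltnW kt) measurableT _ (mA k).
by rewrite setTI.
Qed.

End past.

Lemma tnth_rcons_max m (A : Type) (s : m.-tuple A) (x : A) :
  tnth (rcons_tuple s x) ord_max = x.
Proof. by rewrite (tnth_nth x) /= nth_rcons size_tuple ltnn eqxx. Qed.

Lemma measurable_rcons d d' (T : measurableType d) (T' : measurableType d') m
  (f : T -> m.-tuple T') (g : T -> T') :
  measurable_fun setT f -> measurable_fun setT g ->
  measurable_fun setT (fun x => rcons_tuple (f x) (g x)).
Proof.
move=> mf mg; apply/measurable_fun_tnthP => i.
have [im|mi] := ltnP i m.
  rewrite (_ : _ \o _ = (fun x => tnth (f x) (Ordinal im))).
    exact: (measurableT_comp (measurable_tnth _) mf).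
  apply/funext => x /=.
  by rewrite !(tnth_nth (g x)) /= nth_rcons size_tuple im.
rewrite (_ : _ \o _ = g) //; apply/funext => x /=.
rewrite (tnth_nth (g x)) /= nth_rcons size_tuple ltnNge mi /=.
by rewrite eqn_leq mi -ltnS ltn_ord.
Qed.

Section network_process.
Context (R : realType) (n : nat) (N : network R n).
Context d (T : measurableType d).
Context (y : nat -> {mfun T >-> disturbance R n}).
Context (pol : policy R n).

(* The information at time [t] of the outcome [w], with the disturbance of
   time [t] replaced by [v]. *)
Definition mixed_info (w : T) (t : nat) :
    disturbance R n -> t.+1.-tuple (observation R n) :=
  match t with
  | 0 => fun v => [tuple (sinit N, v)]
  | t'.+1 => fun v =>
    let h := info N y pol w t' in
    rcons_tuple h (next_storage N (tnth h ord_max).1 (@pol t' h), v)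
  end.

Lemma mixed_info_self w t : mixed_info w t (y t w) = info N y pol w t.
Proof. by case: t. Qed.

Lemma mixed_info_last w t v :
  tnth (mixed_info w t v) ord_max = (storage N y pol w t, v).
Proof.
rewrite /storage; case: t => [|t] /=; first by rewrite (tnth_nth (sinit N, v)).
by rewrite !tnth_rcons_max.
Qed.

Lemma storageS w t :
  storage N y pol w t.+1 = next_storage N (storage N y pol w t) (decide N y pol w t).
Proof. by rewrite {1}/storage /= tnth_rcons_max. Qed.

Hypothesis pol_measurable : policy_measurable pol.

Lemma measurable_next_storage d0 (T0 : measurableType d0)
  (s : T0 -> n.-tuple R) (x : T0 -> decision R n) :
  measurable_fun setT s ->
  (forall i, measurable_fun setT (fun w => ctl (x w) i)) ->
  measurable_fun setT (fun w => next_storage N (s w) (x w)).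
Proof.
move=> ms mx; apply/measurable_fun_tnthP => i.
rewrite (_ : _ \o _ = (fun w => lambda N i * tnth (s w) i + ctl (x w) i)).
  apply: measurable_funD => //; apply: measurable_funM => //.
  exact: (measurableT_comp (measurable_tnth i) ms).
by apply/funext => w /=; rewrite tnth_mktuple.
Qed.

Let measurable_info_of_mixed t :
  measurable_fun setT (fun z : past y t * disturbance R n => mixed_info z.1 t z.2) ->
  measurable_fun (setT : set (past y t.+1)) (fun w => info N y pol w t).
Proof.
move=> mmix.
rewrite (_ : (fun w => info N y pol w t) = (fun z : past y t * disturbance R n =>
   mixed_info z.1 t z.2) \o (fun w => (w, y t w))).
  apply: (measurableT_comp mmix); apply: measurable_fun_pair.
    exact: measurable_past_widen.
  exact: measurable_past_obs.
by apply/funext => w /=; rewrite mixed_info_self.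
Qed.

(** Joint measurability in the strict past and a free disturbance is what substitution of an
    independent copy requires. In the induction, the information of the previous period is
    measurable for the enlarged past, and the new disturbance enters only as the last coordinate. *)
Lemma measurable_mixed_info t :
  measurable_fun setT (fun z : past y t * disturbance R n => mixed_info z.1 t z.2).
Proof.
elim: t => [|t IH].
  apply/measurable_fun_tnthP => i.
  rewrite (_ : _ \o _ = (fun z : past y 0 * disturbance R n => (sinit N, z.2))).
    exact: measurable_fun_pair.
  by apply/funext => z /=; rewrite ord1 (tnth_nth (sinit N, z.2)).
have minfo := measurable_info_of_mixed IH.
have minfo1 : measurable_fun setT
    (fun z : past y t.+1 * disturbance R n => info N y pol z.1 t).
  exact: (measurableT_comp minfo measurable_fst).
apply: measurable_rcons => //.
apply: measurable_fun_pair => //.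
apply: measurable_next_storage.
  apply: (measurableT_comp measurable_fst).
  exact: (measurableT_comp (measurable_tnth _) minfo1).
move=> i; have [mctl _ _ _] := pol_measurable t i.
exact: (measurableT_comp mctl minfo1).
Qed.

Lemma measurable_info t :
  measurable_fun (setT : set (past y t.+1)) (fun w => info N y pol w t).
Proof. by apply: measurable_info_of_mixed; exact: measurable_mixed_info. Qed.

(** The level at [t] is settled before the disturbance of [t] is seen, hence the smaller
    sigma-algebra [past y t]; this yields its independence from that disturbance. *)
Lemma measurable_storage t i :
  measurable_fun (setT : set (past y t)) (fun w => tnth (storage N y pol w t) i).
Proof.
(* An arbitrary value: the storage component of [mixed_info] does not depend on it. *)
pose v0 : disturbance R n := ([tuple of nseq n 0], [tuple of nseq n 0]).
rewrite (_ : (fun w => _) = (fun w => tnth (tnth (mixed_info w t v0) ord_max).1 i)).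
  have mv0 : measurable_fun (setT : set (past y t))
      (fun w => (w, v0) : past y t * disturbance R n).
    exact: measurable_fun_pair.
  have m1 := measurableT_comp (@measurable_mixed_info t) mv0.
  have m2 := measurableT_comp (measurable_tnth ord_max) m1.
  exact: measurableT_comp (measurable_tnth i) (measurableT_comp measurable_fst m2).
by apply/funext => w /=; rewrite mixed_info_last.
Qed.

End network_process.

(** * Averaging over time *)

Section averaging.
Context (R : realType) (n : nat) (lam Gam W Mu Ms : 'I_n -> R).
Hypotheses (lam_range : forall i, 0 < lam i <= 1) (W_gt0 : forall i, 0 < W i).
(* [a], [b], [q], [g]: expectations of [s + Gam], [(s + Gam) u], [(s + Gam)^2]
   and the stage cost under the online policy; [sg], [v], [h]: expectations of
   [s], [u] and the stage cost under the competing policy. *)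
Context (a b q : nat -> 'I_n -> R) (g : nat -> R).
Context (sg v : nat -> 'I_n -> R) (h : nat -> R).
Hypothesis one_step : forall t k,
  \sum_i lam i / W i * b t i + g t <= \sum_i lam i / W i * (a t i * v k i) + h k.
Hypothesis drift : forall t i,
  q t.+1 i <= lam i ^+ 2 * q t i
              + 2 * lam i * (b t i + (1 - lam i) * Gam i * a t i) + 2 * Mu i.
Hypothesis v_def : forall k i, v k i = sg k.+1 i - lam i * sg k i.
Hypothesis a_sg : forall t k i, `|a t i * (sg k i + Gam i)| <= Ms i.
Hypothesis q_range : forall t i, 0 <= q t i <= Ms i.

Let excess := \sum_i (2 * lam i * Ms i + Ms i / 2) / W i.
Let M := \sum_i (Mu i + lam i * (1 - lam i) * Ms i) / W i.

Lemma sum_control m i :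
  \sum_(k < m) v k i =
  (1 - lam i) * \sum_(k < m) sg k i + sg m i - sg 0 i.
Proof.
elim: m => [|m IH]; first by rewrite !big_ord0; ring.
by rewrite !big_ord_recr /= IH v_def; ring.
Qed.

(** The telescoped control sum is recentred at [sg + Gam], so each product with [a] is at most [Ms].
    The two boundary terms cost [2 * Ms]; the term in [Gam * a] is kept because it cancels against
    the drift. *)
Lemma sum_control_le t m i :
  a t i * \sum_(k < m) v k i <=
  (1 - lam i) * (m%:R * Ms i) - m%:R * (1 - lam i) * Gam i * a t i + 2 * Ms i.
Proof.
have /andP[l0 l1] := lam_range i.
have -> : a t i * \sum_(k < m) v k i =
    (1 - lam i) * (\sum_(k < m) a t i * (sg k i + Gam i))
    - m%:R * (1 - lam i) * Gam i * a t i
    + a t i * (sg m i + Gam i) - a t i * (sg 0 i + Gam i).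
  rewrite sum_control -mulr_sumr big_split /= sumr_const card_ord -mulr_natl; ring.
have hS : \sum_(k < m) a t i * (sg k i + Gam i) <= m%:R * Ms i.
  rewrite mulr_natl -[m in _ *+ m]card_ord -sumr_const; apply: ler_sum => k _.
  exact: le_trans (ler_norm _) (a_sg _ _ _).
have h1 := le_trans (ler_norm _) (a_sg t m i).
have h2 := a_sg t 0 i; rewrite ler_norml in h2; have /andP[h2' _] := h2.
have : (1 - lam i) * (\sum_(k < m) a t i * (sg k i + Gam i)) <= (1 - lam i) * (m%:R * Ms i).
  by apply: ler_wpM2l => //; lra.
lra.
Qed.

(** Sum the one-step comparison over the competitor's times [k < m], then bound [b] from below by
    the drift inequality; the [Gam * a] terms cancel. *)
Lemma one_period_average t m :
  m%:R * g t <= \sum_i (m%:R * (Mu i + lam i * (1 - lam i) * Ms i)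
     + 2 * lam i * Ms i - m%:R * (q t.+1 i - q t i) / 2) / W i + \sum_(k < m) h k.
Proof.
have : m%:R * (\sum_i lam i / W i * b t i + g t) <=
    \sum_i lam i / W i * (a t i * \sum_(k < m) v k i) + \sum_(k < m) h k.
  rewrite mulr_natl -[m in _ *+ m]card_ord -sumr_const.
  have -> : \sum_i lam i / W i * (a t i * \sum_(k < m) v k i) =
      \sum_(k < m) \sum_i lam i / W i * (a t i * v k i).
    by rewrite exchange_big /=; apply: eq_bigr => i _; rewrite !mulr_sumr.
  by rewrite -big_split /=; apply: ler_sum => k _; exact: one_step.
rewrite mulrDr -lerBrDl => hm; apply: le_trans hm _.
rewrite addrAC lerD2r mulr_sumr -sumrB; apply: ler_sum => i _.
have /andP[l0 l1] := lam_range i; have w0 := W_gt0 i.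
rewrite ler_pdivlMr //.
have -> : (lam i / W i * (a t i * \sum_(k < m) v k i) - m%:R * (lam i / W i * b t i)) * W i
  = lam i * (a t i * \sum_(k < m) v k i) - m%:R * (lam i * b t i).
  by field; rewrite gt_eqF.
have hc := ler_wpM2l (ltW l0) (sum_control_le t m i).
have m0 : 0 <= m%:R :> R by exact: ler0n.
have /andP[q0 _] := q_range t i.
(* Replacing the contraction factor by 1 leaves a difference of [q] that telescopes in [t]. *)
have hq : lam i ^+ 2 * q t i <= q t i.
  by rewrite ler_piMl // expr_le1 // ltW.
have hd : q t.+1 i - q t i <= 2 * lam i * (b t i + (1 - lam i) * Gam i * a t i) + 2 * Mu i.
  by have := drift t i; lra.
have hd' := ler_wpM2l m0 hd.
lra.
Qed.

(** The same horizon is used for the online times and the competitor's times. Horizons start at 1 so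
    that the average is a division by a nonzero number. *)
Lemma averaged_cost_le m :
  m.+1%:R^-1 * \sum_(t < m.+1) g t
  <= m.+1%:R^-1 * \sum_(t < m.+1) h t + M + excess * m.+1%:R^-1.
Proof.
set k := m.+1; have k0 : 0 < k%:R :> R by rewrite ltr0n.
have tel i : \sum_(t < k) (q t.+1 i - q t i) = q k i - q 0 i.
  have := telescope_sumr (q ^~ i) (leq0n k).
  by rewrite big_mkord.
have hs : k%:R * \sum_(t < k) g t <=
   k%:R * (k%:R * M + excess + \sum_(t < k) h t).
  rewrite mulr_sumr.
  apply: le_trans (ler_sum _ (fun (t : 'I_k) _ => one_period_average t k)) _.
  rewrite big_split /= sumr_const card_ord -[X in _ + X]mulr_natl [leRHS]mulrDr lerD2r.
  rewrite exchange_big /= /M /excess mulr_sumr -big_split /= mulr_sumr.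
  apply: ler_sum => i _; rewrite -mulr_suml mulrA -mulrDl mulrA ler_pM2r ?invr_gt0 //.
  rewrite sumrB sumr_const card_ord -mulr_natl -mulr_suml -mulr_sumr tel.
  (* After telescoping, [(q 0 - q k) / 2] is at most [Ms / 2], the second term of [excess]. *)
  have /andP[_ q2] := q_range 0 i; have /andP[q1 _] := q_range k i.
  have := ler_wpM2l (ltW k0) (lerB q2 q1).
  nra.
rewrite ler_pM2l // in hs.
rewrite -(ler_pM2l k0) mulrA divff ?gt_eqF // mul1r.
rewrite !mulrDr !mulrA divff ?gt_eqF // mul1r mulrAC divff ?gt_eqF // mul1r.
lra.
Qed.

End averaging.

Lemma lim_le_of_averages (R : realType) (A B : nat -> R) (M C : R) :
  cvgn A -> cvgn B -> (forall m, A m.+1 <= B m.+1 + M + C * m.+1%:R^-1) ->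
  limn A <= limn B + M.
Proof.
move=> cA cB hAB; rewrite -lerBlDl.
have cV : (fun m : nat => m.+1%:R^-1 : R) @ \oo --> 0 by exact: cvg_harmonic.
have cA1 : (fun m => A m.+1) @ \oo --> limn A by rewrite cvg_shiftS.
have cB1 : (fun m => B m.+1) @ \oo --> limn B by rewrite cvg_shiftS.
have cC : (fun m : nat => A m.+1 - B m.+1 - C * m.+1%:R^-1) @ \oo
    --> limn A - limn B - C * 0.
  by apply: cvgB; [exact: cvgB|exact: cvgMr].
rewrite mulr0 subr0 in cC.
apply: (cvgr_to_le cC); near=> m.
by rewrite !lerBlDr addrAC [M + _]addrC; exact: hAB.
Unshelve. all: by end_near. Qed.

(** * Comparison with a feasible policy *)

Lemma Rintegral_sum d (T : measurableType d) (R : realType)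
  (mu : {measure set T -> \bar R}) (I : finType) (f : I -> T -> R) :
  (forall i, mu.-integrable setT (fun x => (f i x)%:E)) ->
  \int[mu]_x (\sum_i f i x) = \sum_i \int[mu]_x f i x.
Proof.
move=> intf; rewrite /Rintegral.
under eq_integral do rewrite -sumEFin.
rewrite (integral_sum measurableT intf) sum_fine // => i _.
exact: integrable_fin_num (intf i).
Qed.

Lemma integrable_Rsum d (T : measurableType d) (R : realType)
  (mu : {measure set T -> \bar R}) (I : finType) (f : I -> T -> R) :
  (forall i, mu.-integrable setT (fun x => (f i x)%:E)) ->
  mu.-integrable setT (fun x => (\sum_i f i x)%:E).
Proof.
move=> intf; under eq_fun do rewrite -sumEFin.
exact: integrable_sum.
Qed.

Lemma integrable_Radd d (T : measurableType d) (R : realType)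
  (mu : {measure set T -> \bar R}) (f g : T -> R) :
  mu.-integrable setT (fun x => (f x)%:E) ->
  mu.-integrable setT (fun x => (g x)%:E) ->
  mu.-integrable setT (fun x => (f x + g x)%:E).
Proof. exact: integrableD. Qed.

Lemma integrable_Rscale d (T : measurableType d) (R : realType)
  (mu : {measure set T -> \bar R}) (c : R) (f : T -> R) :
  mu.-integrable setT (fun x => (f x)%:E) ->
  mu.-integrable setT (fun x => (c * f x)%:E).
Proof. exact: integrableZl. Qed.

Lemma measurable_forall d (T : measurableType d) (I : finType) (F : I -> set T) :
  (forall i, measurable (F i)) -> measurable [set x | forall i, F i x].
Proof.
move=> mF; rewrite (_ : mkset _ = \bigcap_(i in [set: I]) F i).
  exact: fin_bigcap_measurable.
by apply/seteqP; split => [x Fx i _|x Fx i]; exact: Fx.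
Qed.

Lemma measurable_between d (T : measurableType d) (R : realType) (f : T -> R) (lo hi : R) :
  measurable_fun setT f -> measurable [set x | lo <= f x <= hi].
Proof.
move=> mf; rewrite (_ : mkset _ = f @^-1` `[lo, hi]%classic).
  by rewrite -[X in measurable X]setTI; exact: mf.
by apply/seteqP; split => x /=; rewrite in_itv.
Qed.

Lemma measurable_equal d (T : measurableType d) (R : realType) (f g : T -> R) :
  measurable_fun setT f -> measurable_fun setT g -> measurable [set x | f x = g x].
Proof.
move=> mf mg; rewrite (_ : mkset _ = (f \- g) @^-1` [set 0]).
  by rewrite -[X in measurable X]setTI; apply: measurable_funB.
by apply/seteqP; split => x /= => [->|/eqP]; rewrite ?subrr // subr_eq0 => /eqP.
Qed.

Section one_policy.
Context (R : realType) (n : nat) (N : network R n).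
Context d (T : measurableType d) (P : probability T R).
Context (y : nat -> {mfun T >-> disturbance R n}).
Hypothesis hiid : iid P y.
Hypothesis hrange : disturbance_range N y.

Lemma iid_same_law s t B : measurable B -> P (y s @^-1` B) = P (y t @^-1` B).
Proof.
move=> mB; have [_ hid] := hiid.
by have := hid s B mB; have := hid t B mB; rewrite /distribution /pushforward => -> ->.
Qed.

Lemma iid_past t : independent_generator P (past_events y t) (y t).
Proof. by apply: past_independent; case: hiid. Qed.

Context (pol : policy R n).
Hypothesis mpol : policy_measurable pol.

Lemma measurable_price_range t : measurable
  [set h : t.+1.-tuple (observation R n) | price_range N (tnth h ord_max).2.2].
Proof.
apply: measurable_forall => i; apply: measurable_between.
apply: (measurableT_comp (measurable_tnth i)).
apply: (measurableT_comp measurable_snd).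
apply: (measurableT_comp measurable_snd).
exact: measurable_tnth.
Qed.

(** Needed to transfer the almost sure validity of the constraints from a policy's own trajectory to
    an independent copy. *)
Lemma measurable_period_constraints t : measurable
  [set h : t.+1.-tuple (observation R n) |
    period_constraints N (tnth h ord_max).2.1 (@pol t h)].
Proof.
pose C1 := [set h : t.+1.-tuple (observation R n) |
  forall i, Umin N i <= ctl (@pol t h) i <= Umax N i].
pose C2 := [set h : t.+1.-tuple (observation R n) | forall i,
  tnth (tnth h ord_max).2.1 i + gen (@pol t h) i =
  ctl (@pol t h) i + \sum_(j < n) flw (@pol t h) i j].
pose C3 := [set h : t.+1.-tuple (observation R n) | forall i j,
  Badm N i j * (ang (@pol t h) i - ang (@pol t h) j) = flw (@pol t h) i j].
pose C4 := [set h : t.+1.-tuple (observation R n) | forall i j,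
  - Fmax N i j <= flw (@pol t h) i j <= Fmax N i j].
rewrite (_ : mkset _ = C1 `&` C2 `&` C3 `&` C4); last first.
  by apply/seteqP; split => [h []|h [[[]]]]; do ?split.
apply: measurableI; first (apply: measurableI; first apply: measurableI).
- apply: measurable_forall => i; apply: measurable_between.
  by have [] := mpol t i.
- apply: measurable_forall => i; have [mu mg _ mf] := mpol t i.
  apply: measurable_equal; apply: measurable_funD => //; last exact: measurable_sum.
  apply: (measurableT_comp (measurable_tnth i)).
  apply: (measurableT_comp measurable_fst).
  apply: (measurableT_comp measurable_snd).
  exact: measurable_tnth.
- apply: measurable_forall => i; apply: measurable_forall => j.
  have [_ _ ma mf] := mpol t i; have [_ _ ma' _] := mpol t j.
  apply: measurable_equal => //; apply: measurable_funM => //.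
  exact: measurable_funB.
- apply: measurable_forall => i; apply: measurable_forall => j.
  by apply: measurable_between; have [_ _ _] := mpol t i.
Qed.


Lemma measurable_storageT t i :
  measurable_fun setT (fun w => tnth (storage N y pol w t) i).
Proof.
exact: measurableT_comp (@measurable_storage _ _ N _ _ y _ mpol t i)
  (measurable_to_past (iid_past t)).
Qed.

Lemma measurable_decide_ctl t i :
  measurable_fun setT (fun w => ctl (decide N y pol w t) i).
Proof.
have [mu _ _ _] := mpol t i; apply: (measurableT_comp mu).
exact: measurableT_comp (@measurable_info _ _ N _ _ y _ mpol t)
  (measurable_to_past (iid_past t.+1)).
Qed.

(* Clipping changes nothing on the outcomes of a feasible policy and makes the
   control bounded on all of [past t * disturbance]. *)
Definition clipped_ctl t i (z : T * disturbance R n) : R :=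
  Num.max (Umin N i)
    (Num.min (Umax N i) (ctl (@pol t (mixed_info N y pol z.1 t z.2)) i)).

(** The stage cost is assumed measurable only on the admissible prices; extending it by a constant
    elsewhere gives a function measurable everywhere and unchanged on observed prices. *)
Definition priced_cost t (z : T * disturbance R n) : R :=
  ((fun h => stage_cost N (tnth h ord_max).2.2 (@pol t h))
    \_ [set h | price_range N (tnth h ord_max).2.2])
  (mixed_info N y pol z.1 t z.2).

Lemma measurable_clipped_ctl t i :
  measurable_fun (setT : set (past y t * disturbance R n)%type)
    (clipped_ctl t i).
Proof.
have [mu _ _ _] := mpol t i.
apply: measurable_maxr => //; apply: measurable_minr => //.
exact: measurableT_comp mu (@measurable_mixed_info _ _ N _ _ y _ mpol t).
Qed.

Lemma clipped_ctl_le t i z : `|clipped_ctl t i z| <= `|Umin N i| + `|Umax N i|.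
Proof.
rewrite /clipped_ctl; set u := ctl _ _.
have [h1 h2] := (ler_norm (Umin N i), ler_norm (Umax N i)).
have := ler_norm (- Umin N i); have := ler_norm (- Umax N i).
rewrite !normrN => h3 h4.
have [h5 h6] := (normr_ge0 (Umin N i), normr_ge0 (Umax N i)).
rewrite ler_norml; apply/andP; split.
  by rewrite le_max; apply/orP; left; lra.
by rewrite ge_max ge_min; apply/andP; split; [lra|apply/orP; left; lra].
Qed.

Lemma clipped_ctlE t i z :
  Umin N i <= ctl (@pol t (mixed_info N y pol z.1 t z.2)) i <= Umax N i ->
  clipped_ctl t i z = ctl (@pol t (mixed_info N y pol z.1 t z.2)) i.
Proof. by move=> /andP[h1 h2]; rewrite /clipped_ctl min_r // max_r. Qed.

Lemma priced_costE t z : price_range N z.2.2 ->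
  priced_cost t z = stage_cost N z.2.2 (@pol t (mixed_info N y pol z.1 t z.2)).
Proof.
move=> hz; rewrite /priced_cost patchE mixed_info_last mem_set //=.
by rewrite mixed_info_last.
Qed.

Hypothesis cpol : cost_exists N P y pol.
Hypothesis fpol : feasible N y pol.

Lemma observed_price w t : price_range N (y t w).2.
Proof. by move=> i; have [_] := hrange t w i. Qed.

Lemma measurable_priced_cost t :
  measurable_fun (setT : set (past y t * disturbance R n)%type) (priced_cost t).
Proof.
have [mc _ _] := cpol.
have mres := mc t.
rewrite -[X in measurable_fun X _]setTI in mres.
rewrite (measurable_restrict _ (@measurable_price_range t) measurableT) in mres.
exact: measurableT_comp mres (@measurable_mixed_info _ _ N _ _ y _ mpol t).
Qed.

Lemma clipped_ctl_self w t i :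
  clipped_ctl t i (w, y t w) = ctl (decide N y pol w t) i.
Proof.
have [[hu _ _ _] _ _] := fpol w t; have := hu i.
by move=> hui; rewrite clipped_ctlE /= mixed_info_self.
Qed.

Lemma priced_cost_self w t :
  priced_cost t (w, y t w) = stage_cost N (y t w).2 (decide N y pol w t).
Proof. by rewrite priced_costE ?mixed_info_self //; exact: observed_price. Qed.

Lemma integrable_cost t :
  P.-integrable setT (fun w => (stage_cost N (y t w).2 (decide N y pol w t))%:E).
Proof. by have [_] := cpol. Qed.

Lemma decide_ctl_le w t i :
  `|ctl (decide N y pol w t) i| <= `|Umin N i| + `|Umax N i|.
Proof. by rewrite -clipped_ctl_self clipped_ctl_le. Qed.

Lemma integrable_ctl t i :
  P.-integrable setT (fun w => (ctl (decide N y pol w t) i)%:E).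
Proof.
apply: bounded_integrable (measurable_decide_ctl t i) _ => w.
exact: decide_ctl_le.
Qed.

Lemma storage_le w t i (c : R) :
  `|tnth (storage N y pol w t) i + c| <= `|Smin N i + c| + `|Smax N i + c|.
Proof.
have [_ _ hs] := fpol w t; have /andP[s1 s2] := hs i.
have h1 := ler_norm (Smax N i + c); have := ler_norm (- (Smin N i + c)).
rewrite normrN => h2.
have [h5 h6] := (normr_ge0 (Smin N i + c), normr_ge0 (Smax N i + c)).
by rewrite ler_norml; apply/andP; split; lra.
Qed.

Lemma integrable_storage t i (c : R) :
  P.-integrable setT (fun w => (tnth (storage N y pol w t) i + c)%:E).
Proof.
apply: bounded_integrable (fun w => storage_le w t i c).
by apply: measurable_funD => //; exact: measurable_storageT.
Qed.

End one_policy.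

Section comparison.
Context (R : realType) (n : nat) (N : network R n).
Context d (T : measurableType d) (P : probability T R).
Context (y : nat -> {mfun T >-> disturbance R n}).
Hypotheses (hiid : iid P y) (hrange : disturbance_range N y).
Context (Gamma W : 'I_n -> R) (ol pol : policy R n).
Hypotheses (mol : policy_measurable ol) (col : cost_exists N P y ol)
  (fol : feasible N y ol) (hol : OMG N y Gamma W ol).
Hypotheses (mpol : policy_measurable pol) (cpol : cost_exists N P y pol)
  (fpol : feasible N y pol).

Let shifted t i w := tnth (storage N y ol w t) i + Gamma i.

(* At time [t] the online policy is compared with the decision that [pol]
   takes at time [k] on the past of an independent outcome [z.1] and the
   current disturbance of [z.2]. *)
Lemma online_comparison t k (z : T * T) :
  period_constraints N (y t z.2).1 (@pol k (mixed_info N y pol z.1 k (y t z.2))) ->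
  \sum_i lambda N i / W i * (shifted t i z.2 * ctl (decide N y ol z.2 t) i)
    + stage_cost N (y t z.2).2 (decide N y ol z.2 t) <=
  \sum_i lambda N i / W i * (shifted t i z.2 * clipped_ctl N y pol k i (z.1, y t z.2))
    + priced_cost N y pol k (z.1, y t z.2).
Proof.
move=> hz; have [_ /(_ _ hz)] := hol z.2 t.
rewrite /online_objective !big_split /= -!/(stage_cost _ _ _).
rewrite priced_costE; last exact: (observed_price hrange).
under eq_bigr do rewrite -mulrA; under [X in _ <= X + _]eq_bigr do rewrite -mulrA.
move=> h; apply: le_trans h _; rewrite lerD2r; apply: ler_sum => i _.
by have [/(_ i) hu _ _ _] := hz; rewrite clipped_ctlE.
Qed.

Let bound t i w : `|shifted t i w| <= `|Smin N i + Gamma i| + `|Smax N i + Gamma i|.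
Proof. exact: (storage_le fol). Qed.

(** Integrate [online_comparison] over pairs of outcomes. The left side depends on the second
    outcome only; on the right, [cross_mul] factors the storage terms and the independent copy
    returns the cost of [pol] to time [k]. *)
Lemma expected_online_comparison t k :
  \sum_i lambda N i / W i *
      (\int[P]_w (shifted t i w * ctl (decide N y ol w t) i))
    + \int[P]_w stage_cost N (y t w).2 (decide N y ol w t) <=
  \sum_i lambda N i / W i *
      (\int[P]_w shifted t i w * \int[P]_w ctl (decide N y pol w k) i)
    + \int[P]_w stage_cost N (y k w).2 (decide N y pol w k).
Proof.
have mshift i : measurable_fun (setT : set (past y t)) (shifted t i).
  by apply: measurable_funD => //; exact: @measurable_storage _ _ N _ _ y _ mol t i.
have mshiftT i : measurable_fun setT (shifted t i).
  exact: measurableT_comp (mshift i) (measurable_to_past (iid_past hiid t)).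
have ibT i : P.-integrable setT
    (fun w => (shifted t i w * ctl (decide N y ol w t) i)%:E).
  apply: (@bounded_integrable _ _ _ _ _ ((`|Smin N i + Gamma i| + `|Smax N i + Gamma i|)
      * (`|Umin N i| + `|Umax N i|))) => [|w].
    apply: measurable_funM => //.
    exact: (@measurable_decide_ctl _ _ N _ _ P y hiid ol mol t i).
  rewrite normrM; apply: ler_pM => //; exact: (decide_ctl_le fol).
have law := iid_same_law hiid.
have mcopy := measurable_past_copy (y t) (iid_past hiid k).
pose U i := clipped_ctl N y pol k i; pose G := priced_cost N y pol k.
have mU i : measurable_fun setT (fun z : T * T => U i (z.1, y t z.2)).
  exact: measurableT_comp (@measurable_clipped_ctl _ _ N _ _ y pol mpol k i) mcopy.
have intU i : (P \x P)%E.-integrable setT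
    (fun z => (shifted t i z.2 * U i (z.1, y t z.2))%:E).
  apply: (@bounded_integrable _ _ _ _ _ ((`|Smin N i + Gamma i| + `|Smax N i + Gamma i|)
      * (`|Umin N i| + `|Umax N i|))) => [|z].
    apply: measurable_funM => //.
    exact: (measurableT_comp (mshiftT i) measurable_snd).
  rewrite normrM; apply: ler_pM => //; exact: clipped_ctl_le.
have mG := measurable_priced_cost mpol cpol (t := k).
have intGk : P.-integrable setT (fun w => (G (w, y k w))%:E).
  under eq_fun do rewrite /G (priced_cost_self hrange).
  exact: (integrable_cost cpol).
have intG := independent_copy_integrable (iid_past hiid k) (law k t) mG intGk.
pose C i := lambda N i / W i.
pose O w := \sum_i C i * (shifted t i w * ctl (decide N y ol w t) i)
  + stage_cost N (y t w).2 (decide N y ol w t).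
pose Q (z : T * T) := \sum_i C i * (shifted t i z.2 * U i (z.1, y t z.2))
  + G (z.1, y t z.2).
have intSO : P.-integrable setT
    (fun w => (\sum_i C i * (shifted t i w * ctl (decide N y ol w t) i))%:E).
  by apply: integrable_Rsum => i; exact: integrable_Rscale.
have intO : P.-integrable setT (fun w => (O w)%:E).
  by apply: integrable_Radd => //; exact: (integrable_cost col).
have intSQ : (P \x P)%E.-integrable setT
    (fun z => (\sum_i C i * (shifted t i z.2 * U i (z.1, y t z.2)))%:E).
  by apply: integrable_Rsum => i; exact: integrable_Rscale.
have intQ : (P \x P)%E.-integrable setT (fun z => (Q z)%:E).
  exact: integrable_Radd.
have mO : measurable_fun setT O by have /measurable_int/measurable_EFinP := intO.
pose good : set (past y k * disturbance R n) := [set z |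
  period_constraints N z.2.1 (@pol k (mixed_info N y pol z.1 k z.2))].
have mgood : measurable good.
  have := @measurable_mixed_info _ _ N _ _ y _ mpol k measurableT _
    (@measurable_period_constraints _ _ N pol mpol k).
  rewrite setTI; congr measurable; apply/seteqP.
  by split => z /=; rewrite mixed_info_last.
(* The exceptional set consists of the pairs on which the transplanted decision violates the
   constraints. *)
have := le_Rintegral_null (integrable_snd P mO intO) intQ
  (A := (fun z : T * T => (z.1, y t z.2)) @^-1` (~` good)).
have -> : \int[(P \x P)%E]_z O z.2 = \sum_i C i *
      (\int[P]_w (shifted t i w * ctl (decide N y ol w t) i))
    + \int[P]_w stage_cost N (y t w).2 (decide N y ol w t).
  rewrite Rintegral_snd // RintegralD //; last exact: (integrable_cost col).
  rewrite Rintegral_sum => [|i]; last exact: integrable_Rscale.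
  congr (_ + _); apply: eq_bigr => i _; rewrite RintegralZl //; exact: ibT.
have -> : \int[(P \x P)%E]_z Q z = \sum_i C i *
      (\int[P]_w shifted t i w * \int[P]_w ctl (decide N y pol w k) i)
    + \int[P]_w stage_cost N (y k w).2 (decide N y pol w k).
  rewrite RintegralD // Rintegral_sum => [|i]; last exact: integrable_Rscale.
  congr (_ + _).
    apply: eq_bigr => i _; rewrite RintegralZl //; last exact: intU.
    congr (_ * _).
    rewrite (cross_mul (iid_past hiid t) (iid_past hiid k) (law t k) (mshift i)
      (@measurable_clipped_ctl _ _ N _ _ y pol mpol k i) (bound t i)
      (@clipped_ctl_le _ _ N _ _ y pol k i)).
    congr (_ * _); apply: eq_Rintegral => w _.
    exact: (clipped_ctl_self fpol).
  rewrite -(independent_copy_integral (iid_past hiid k) (law k t) mG intGk).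
  apply: eq_Rintegral => w _; exact: (priced_cost_self hrange).
apply.
- by rewrite -[X in measurable X]setTI; apply: mcopy => //; exact: measurableC.
(* By equality of laws, this set has the probability that [pol] violates the constraints on its own
   trajectory at time [k], which never happens. *)
- apply: etrans (esym (independent_copy_law (iid_past hiid k) (law k t)
    (measurableC mgood))) _.
  rewrite (_ : _ @^-1` _ = set0) ?measure0 //; apply/seteqP; split => // w /=; apply.
  by rewrite /good /= mixed_info_self; have [] := fpol w k.
- by move=> z /= /contrapT; exact: online_comparison.
Qed.

End comparison.

(** * Drift of the squared shifted storage level *)

Lemma sqr_le_max_ends (R : realType) (lo hi p : R) : lo <= p <= hi ->
  p ^+ 2 <= Num.max (lo ^+ 2) (hi ^+ 2).
Proof.
move=> /andP[lp ph]; rewrite le_max; have [p0|p0] := leP 0 p.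
  by apply/orP; right; nra.
by apply/orP; left; nra.
Qed.

(** [2 * |p * q| <= p ^+ 2 + q ^+ 2], and each square is at most the larger endpoint square. *)
Lemma norm_mul_le_max_ends (R : realType) (lo hi p q : R) :
  lo <= p <= hi -> lo <= q <= hi -> `|p * q| <= Num.max (lo ^+ 2) (hi ^+ 2).
Proof.
move=> /sqr_le_max_ends hp /sqr_le_max_ends hq; rewrite ler_norml.
have := sqr_ge0 (p + q); have := sqr_ge0 (p - q).
by move=> h1 h2; apply/andP; split; nra.
Qed.

Lemma Rintegral_prob_cst d (T : measurableType d) (R : realType)
  (P : probability T R) (c : R) : \int[P]_w c = c.
Proof.
transitivity (c * fine (P setT)); first exact: Rintegral_cst.
by rewrite (probability_setT P) mulr1.
Qed.

Lemma Rintegral_between d (T : measurableType d) (R : realType)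
  (P : probability T R) (f : T -> R) (lo hi : R) :
  P.-integrable setT (fun w => (f w)%:E) -> (forall w, lo <= f w <= hi) ->
  lo <= \int[P]_w f w <= hi.
Proof.
move=> intf hf.
have Ec := Rintegral_prob_cst P.
have intc (c : R) : P.-integrable setT (fun=> c%:E).
  exact: finite_measure_integrable_cst.
rewrite -{1}(Ec lo) -[X in _ <= _ <= X](Ec hi).
by apply/andP; split; apply: le_Rintegral => //;
  first [exact: intc|by move=> w _; have /andP[] := hf w].
Qed.

Section drift.
Context (R : realType) (n : nat) (N : network R n).
Context d (T : measurableType d) (P : probability T R).
Context (y : nat -> {mfun T >-> disturbance R n}).
Hypotheses (hiid : iid P y).
Context (Gamma : 'I_n -> R) (pol : policy R n).
Hypotheses (mpol : policy_measurable pol) (fpol : feasible N y pol).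

Let shifted t i w := tnth (storage N y pol w t) i + Gamma i.
Let u t i w := ctl (decide N y pol w t) i.

Lemma shifted_range t i w :
  Smin N i + Gamma i <= shifted t i w <= Smax N i + Gamma i.
Proof. by have [_ _ hs] := fpol w t; rewrite !lerD2r. Qed.

Lemma shifted_sqr_range t i w : 0 <= shifted t i w ^+ 2 <= Ms N i (Gamma i).
Proof.
by rewrite sqr_ge0 /=; apply: sqr_le_max_ends; exact: shifted_range.
Qed.

Lemma measurable_shifted t i : measurable_fun setT (shifted t i).
Proof.
by apply: measurable_funD => //; exact: (@measurable_storageT _ _ N _ _ P y hiid pol mpol t i).
Qed.

Lemma integrable_shifted_sqr t i :
  P.-integrable setT (fun w => (shifted t i w ^+ 2)%:E).
Proof.
apply: (@bounded_integrable _ _ _ _ _ (Ms N i (Gamma i))) => [|w].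
  by apply: measurable_funX; exact: measurable_shifted.
by have /andP[h0 h1] := shifted_sqr_range t i w; rewrite ger0_norm.
Qed.

Lemma integrable_shifted_ctl t i :
  P.-integrable setT (fun w => (shifted t i w * u t i w)%:E).
Proof.
apply: (@bounded_integrable _ _ _ _ _ ((`|Smin N i + Gamma i| + `|Smax N i + Gamma i|)
      * (`|Umin N i| + `|Umax N i|))) => [|w].
  apply: measurable_funM; first exact: measurable_shifted.
  exact: (@measurable_decide_ctl _ _ N _ _ P y hiid pol mpol t i).
rewrite normrM; apply: ler_pM => //; last exact: (decide_ctl_le fpol).
exact: (storage_le fpol).
Qed.

Lemma storage_step t i w : tnth (storage N y pol w t.+1) i =
  lambda N i * tnth (storage N y pol w t) i + u t i w.
Proof. by have [_ ->] := fpol w t. Qed.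

Lemma expected_storage_step t i :
  \int[P]_w tnth (storage N y pol w t.+1) i =
  lambda N i * (\int[P]_w tnth (storage N y pol w t) i) + \int[P]_w u t i w.
Proof.
have ints k : P.-integrable setT (fun w => (tnth (storage N y pol w k) i)%:E).
  have := integrable_storage hiid mpol fpol k i 0.
  by under eq_fun do rewrite addr0.
have intls : P.-integrable setT
    (fun w => (lambda N i * tnth (storage N y pol w t) i)%:E).
  exact: integrable_Rscale.
have intu : P.-integrable setT (fun w => (u t i w)%:E).
  exact: (integrable_ctl hiid mpol fpol).
transitivity (\int[P]_w (lambda N i * tnth (storage N y pol w t) i + u t i w)).
  by apply: eq_Rintegral => w _; rewrite storage_step.
by rewrite RintegralD // RintegralZl //; exact: ints.
Qed.

(** The next shifted level is [lambda * (s + Gamma) + (u + (1 - lambda) * Gamma)]. Expanding its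
    square, the last summand squared is at most [2 * Mu], because its range is an interval with the
    endpoints used in [Mu]. *)
Lemma sqr_drift t i w :
  shifted t.+1 i w ^+ 2 <= lambda N i ^+ 2 * shifted t i w ^+ 2
    + 2 * lambda N i * (shifted t i w * u t i w
                        + (1 - lambda N i) * Gamma i * shifted t i w)
    + 2 * Mu N i (Gamma i).
Proof.
have [[hu _ _ _] _ _] := fpol w t; have /andP[u1 u2] := hu i.
have : Umin N i + (1 - lambda N i) * Gamma i <= u t i w + (1 - lambda N i) * Gamma i
  <= Umax N i + (1 - lambda N i) * Gamma i by rewrite !lerD2r; exact: hu.
have -> : 2 * Mu N i (Gamma i) =
    Num.max ((Umin N i + (1 - lambda N i) * Gamma i) ^+ 2)
            ((Umax N i + (1 - lambda N i) * Gamma i) ^+ 2).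
  by rewrite /Mu mulrA divff ?mul1r ?pnatr_eq0.
move=> /sqr_le_max_ends; rewrite /shifted storage_step.
set M := Num.max _ _; set s := tnth _ _; set l := lambda N i; set v := u t i w.
move=> h; have -> : (l * s + v + Gamma i) ^+ 2 =
  l ^+ 2 * (s + Gamma i) ^+ 2 + 2 * l * ((s + Gamma i) * v + (1 - l) * Gamma i * (s + Gamma i))
  + (v + (1 - l) * Gamma i) ^+ 2 by ring.
by rewrite lerD2l.
Qed.

Lemma expected_sqr_drift t i :
  \int[P]_w (shifted t.+1 i w ^+ 2) <=
  lambda N i ^+ 2 * (\int[P]_w (shifted t i w ^+ 2))
    + 2 * lambda N i * (\int[P]_w (shifted t i w * u t i w)
        + (1 - lambda N i) * Gamma i * \int[P]_w shifted t i w)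
    + 2 * Mu N i (Gamma i).
Proof.
have ints : P.-integrable setT (fun w => (shifted t i w)%:E).
  exact: (integrable_storage hiid mpol fpol).
have Ec := Rintegral_prob_cst P.
have intc (c : R) : P.-integrable setT (fun=> c%:E).
  exact: finite_measure_integrable_cst.
have intq := integrable_shifted_sqr t i.
have intb := integrable_shifted_ctl t i.
pose F1 w := lambda N i ^+ 2 * shifted t i w ^+ 2.
pose F2 w := shifted t i w * u t i w + (1 - lambda N i) * Gamma i * shifted t i w.
have intcs : P.-integrable setT
    (fun w => ((1 - lambda N i) * Gamma i * shifted t i w)%:E).
  exact: integrable_Rscale.
have int1 : P.-integrable setT (fun w => (F1 w)%:E) by exact: integrable_Rscale.
have int2 : P.-integrable setT (fun w => (F2 w)%:E) by exact: integrable_Radd.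
have int2' : P.-integrable setT (fun w => (2 * lambda N i * F2 w)%:E).
  exact: integrable_Rscale.
have int12 : P.-integrable setT (fun w => (F1 w + 2 * lambda N i * F2 w)%:E).
  exact: integrable_Radd.
have int3 := intc (2 * Mu N i (Gamma i)).
have <- : \int[P]_w (F1 w + 2 * lambda N i * F2 w + 2 * Mu N i (Gamma i)) =
    lambda N i ^+ 2 * (\int[P]_w (shifted t i w ^+ 2))
    + 2 * lambda N i * (\int[P]_w (shifted t i w * u t i w)
        + (1 - lambda N i) * Gamma i * \int[P]_w shifted t i w)
    + 2 * Mu N i (Gamma i).
  have E1 : \int[P]_w F1 w = lambda N i ^+ 2 * \int[P]_w (shifted t i w ^+ 2).
    by rewrite RintegralZl.
  have E2 : \int[P]_w (2 * lambda N i * F2 w) = 2 * lambda N i * \int[P]_w F2 w.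
    by rewrite RintegralZl.
  have E3 : \int[P]_w F2 w = \int[P]_w (shifted t i w * u t i w)
      + \int[P]_w ((1 - lambda N i) * Gamma i * shifted t i w).
    by rewrite RintegralD.
  have E4 : \int[P]_w ((1 - lambda N i) * Gamma i * shifted t i w) =
      (1 - lambda N i) * Gamma i * \int[P]_w shifted t i w.
    by rewrite RintegralZl //; exact: ints.
  rewrite RintegralD // Ec; congr (_ + _).
  by rewrite RintegralD // E1 E2 E3 E4.
apply: le_Rintegral => //; last by move=> w _; exact: sqr_drift.
- exact: integrable_shifted_sqr.
- exact: integrable_Radd.
Qed.

End drift.

(** * Feasibility and the cost bound *)

Section policy_cost.
Context (R : realType) (n : nat) (N : network R n).
Context d (T : measurableType d) (P : probability T R).
Context (y : nat -> {mfun T >-> disturbance R n}).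
Hypotheses (hN : network_assumptions N) (hiid : iid P y)
  (hrange : disturbance_range N y).

Lemma average_costE (pol : policy R n) m : cost_exists N P y pol ->
  average_cost N P y pol m = m%:R^-1 *
    \sum_(t < m) \int[P]_w stage_cost N (y t w).2 (decide N y pol w t).
Proof.
move=> cpol; rewrite /average_cost unlock -Rintegral_sum // => t.
exact: (integrable_cost cpol).
Qed.

Lemma storage_feasible (Gamma W Dlo Dhi : 'I_n -> R) (ol : policy R n) :
  (forall i, Dg_bounds N i (Dlo i) (Dhi i)) -> (forall i, 0 < W i) ->
  (forall i, Gamma_min N i (W i) (Dlo i) <= Gamma i
             <= Gamma_max N i (W i) (Dhi i)) ->
  OMG N y Gamma W ol -> feasible N y ol.
Proof.
move=> hD W0 hG hol.
have step w t i : tnth (storage N y ol w t.+1) i =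
    lambda N i * tnth (storage N y ol w t) i + ctl (decide N y ol w t) i.
  by rewrite storageS tnth_mktuple.
have hs w t : forall i, Smin N i <= tnth (storage N y ol w t) i <= Smax N i.
  elim: t => [|t IH] i.
    exact: sinit_range hN i.
  have [hd hp] := hrange t w i; rewrite step.
  exact: (online_next_storage_range hN (hD i) (W0 i) hd hp (hol w t) (hG i) (IH i)).
by move=> w t; split => //; have [] := hol w t.
Qed.

Lemma online_cost_le (Gamma W : 'I_n -> R) (ol pol : policy R n) :
  (forall i, 0 < W i) -> OMG N y Gamma W ol ->
  admissible N P y ol -> feasible N y ol ->
  admissible N P y pol -> feasible N y pol ->
  J N P y ol <= J N P y pol + \sum_(i < n) Mi N i (Gamma i) / W i.
Proof.
move=> W0 hol [mol col] fol [mpol cpol] fpol.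
have [[_ _ cvol] [_ _ cvpol]] := (col, cpol).
apply: (lim_le_of_averages cvol cvpol (C := \sum_i
  (2 * lambda N i * Ms N i (Gamma i) + Ms N i (Gamma i) / 2) / W i)) => m.
rewrite !average_costE //.
pose shifted t i w := tnth (storage N y ol w t) i + Gamma i.
apply: (@averaged_cost_le _ _ (lambda N) Gamma W (fun i => Mu N i (Gamma i))
  (fun i => Ms N i (Gamma i)) (lambda_range hN) W0
  (fun t i => \int[P]_w shifted t i w)
  (fun t i => \int[P]_w (shifted t i w * ctl (decide N y ol w t) i))
  (fun t i => \int[P]_w (shifted t i w ^+ 2))
  (fun t => \int[P]_w stage_cost N (y t w).2 (decide N y ol w t))
  (fun k i => \int[P]_w tnth (storage N y pol w k) i)
  (fun k i => \int[P]_w ctl (decide N y pol w k) i)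
  (fun k => \int[P]_w stage_cost N (y k w).2 (decide N y pol w k))).
- exact: (expected_online_comparison hiid hrange mol col fol hol mpol cpol fpol).
- exact: (expected_sqr_drift hiid Gamma mol fol).
- move=> k i; rewrite (expected_storage_step hiid mpol fpol); ring.
(* Both mean shifted levels, online and competing, lie in the interval from [Smin + Gamma] to
   [Smax + Gamma]. *)
- move=> t k i; rewrite /Ms; apply: norm_mul_le_max_ends.
    apply: Rintegral_between; first exact: (integrable_storage hiid mol fol).
    exact: (shifted_range Gamma fol).
  rewrite !lerD2r; apply: Rintegral_between.
    have := integrable_storage hiid mpol fpol k i 0.
    by under eq_fun do rewrite addr0.
  by move=> w; have [_ _] := fpol w k.
- move=> t i; apply: Rintegral_between.
    exact: (integrable_shifted_sqr hiid Gamma mol fol).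
  exact: (shifted_sqr_range Gamma fol).
Qed.

End policy_cost.

Theorem theorem1 (R : realType) (n : nat) (N : network R n)
    (d : measure_display) (T : measurableType d) (P : probability T R)
    (y : nat -> {mfun T >-> disturbance R n})
    (Dlo Dhi Gamma W : 'I_n -> R) (ol : policy R n)
    (hN : network_assumptions N)
    (hiid : iid P y)
    (hrange : disturbance_range N y)
    (hD : forall i, Dg_bounds N i (Dlo i) (Dhi i))
    (hW : forall i, 0 < W i <= W_max N i (Dlo i) (Dhi i))
    (hGamma : forall i, Gamma_min N i (W i) (Dlo i) <= Gamma i
                        <= Gamma_max N i (W i) (Dhi i))
    (hadm : admissible N P y ol)
    (hol : OMG N y Gamma W ol) :
  feasible N y ol /\
  Jstar N P y <= J N P y ol
    <= Jstar N P y + \sum_(i < n) Mi N i (Gamma i) / W i.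
Proof.
have W0 i : 0 < W i by have /andP[] := hW i.
have fol := storage_feasible hN hrange hD W0 hGamma hol.
split => //; set M := \sum_(i < n) _.
pose costs := [set J N P y pol |
  pol in [set pol | admissible N P y pol /\ feasible N y pol]].
(* This lower bound, with [ol] itself in [costs], makes the infimum a genuine one and yields both
   inequalities. *)
have lb : lbound costs (J N P y ol - M).
  move=> _ [pol [apol fpol] <-]; rewrite lerBlDr.
  exact: online_cost_le.
have Jol : costs (J N P y ol) by exists ol.
apply/andP; split; first by apply: ge_inf Jol; exists (J N P y ol - M).
by rewrite -lerBlDr; apply: lb_le_inf lb; exists (J N P y ol).
Qed.
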